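(* Let $q$ be a prime power and $r$ a positive integer. Then $s_{q^{2r}/q}(3,2)=r+2$ holds if any one of the following is true: (a) $r\not\equiv 3,5 \pmod 6$ and $r\ge4$; (b) $r$ is odd and there is an integer $s$ with $1\le s\le r$, $\gcd(r,s)=1$ and $\gcd\big(r,(q^{2s}-q^s+1)!\big)=1$; (c) $r=5$ and $q=p^{15h+s}$ with $p\in\{2,3\}$, $h\ge0$ an integer and $\gcd(s,15)=1$; (d) $r=5$ and $q=5^{15h+1}$ with $h\ge0$ an integer; (e) $r=5$ and either $q$ is odd with $q\equiv 2,3\pmod 5$, or $q=2^{2h+1}$ with $h\ge1$.
   Context: An $[n,k]_{q^{2r}/q}$ system is an $n$-dimensional $\mathbb{F}_q$-subspace $\mathcal{U}\le\mathbb{F}_{q^{2r}}^k$ with $\langle\mathcal{U}\rangle_{\mathbb{F}_{q^{2r}}}=\mathbb{F}_{q^{2r}}^k$; its linear set is $L_\mathcal{U}=\{\langle u\rangle:u\in\mathcal{U}\setminus\{0\}\}\subseteq\mathrm{PG}(k-1,q^{2r})$. A point set is $t$-saturating if every point of $\mathrm{PG}(k-1,q^{2r})$ lies in the span of some $t+1$ of its points and $t$ is minimal with this property; $\mathcal{U}$ is rank-$\rho$-saturating if $L_\mathcal{U}$ is $(\rho-1)$-saturating. $s_{q^{2r}/q}(k,\rho)$ is the minimum $n$ such that an $[n,k]_{q^{2r}/q}$ rank-$\rho$-saturating system exists. *)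

(* Defs.v *)
From HB Require Import structures.
From mathcomp Require Export all_boot all_order all_algebra all_field.

Set Implicit Arguments.
Unset Strict Implicit.
Unset Printing Implicit Defensive.

Import GRing.Theory.

Local Open Scope ring_scope.

Section Systems.

Variables (F : finFieldType) (L : fieldExtType F) (k : nat).

(* L^k is used in two guises: {ffun 'I_k -> L} carries its F-vector space
   structure and 'rV[L]_k its L-vector space structure; Lrow identifies them. *)
Definition Lrow (u : {ffun 'I_k -> L}) : 'rV[L]_k := \row_i u i.

(* The L-span of U; see Lspan_subP for its universal property. *)
Definition Lspan (U : {vspace {ffun 'I_k -> L}}) : {vspace 'rV[L]_k} :=
  <<[seq Lrow u | u <- vbasis U]>>%VS.

Lemma Lspan_subP (U : {vspace {ffun 'I_k -> L}}) (W : {vspace 'rV[L]_k}) :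
  reflect (forall u, u \in U -> Lrow u \in W) (Lspan U <= W)%VS.
Proof.
apply: (iffP span_subvP) => [sUW u uU | sUW _ /mapP[u uU ->]].
  rewrite (coord_vbasis uU).
  have -> : Lrow (\sum_i coord (vbasis U) i u *: (vbasis U)`_i)
      = \sum_i (coord (vbasis U) i u)%:A *: Lrow (vbasis U)`_i.
    apply/rowP => j; rewrite !mxE sum_ffunE summxE; apply: eq_bigr => i _.
    by rewrite !mxE ffunE mulr_algl.
  apply: memv_suml => i _; apply/memvZ/sUW/map_f/mem_nth.
  by rewrite size_tuple.
by apply: sUW; apply: vbasis_mem.
Qed.

Definition is_system (n : nat) (U : {vspace {ffun 'I_k -> L}}) : Prop :=
  \dim U = n /\ Lspan U = fullv.

(* Points of PG(k-1, L) are the one-dimensional L-subspaces of L^k. *)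
Definition is_point (P : {vspace 'rV[L]_k}) : Prop := \dim P = 1%N.

Definition linear_set (U : {vspace {ffun 'I_k -> L}})
    (P : {vspace 'rV[L]_k}) : Prop :=
  exists u, [/\ u \in U, u != 0 & P = <[Lrow u]>%VS].

Definition saturates (t : nat) (S : {vspace 'rV[L]_k} -> Prop) : Prop :=
  forall Q, is_point Q ->
    exists Ps : t.+1.-tuple {vspace 'rV[L]_k},
      [/\ uniq Ps, forall P, P \in Ps -> S P & (Q <= \sum_(P <- Ps) P)%VS].

Definition saturating (t : nat) (S : {vspace 'rV[L]_k} -> Prop) : Prop :=
  saturates t S /\ forall t', saturates t' S -> (t <= t')%N.

(* Only positive rho is meaningful, so that rho - 1 is not truncated. *)
Definition rank_saturating (rho : nat) (U : {vspace {ffun 'I_k -> L}}) : Prop :=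
  (0 < rho)%N /\ saturating rho.-1 (linear_set U).

Definition has_rank_saturating_system (rho n : nat) : Prop :=
  exists U, is_system n U /\ rank_saturating rho U.

End Systems.

(* "s_{L/F}(k, rho) = n": n is the minimum length of an [n, k]_{L/F}
   rank-rho-saturating system. *)
Definition min_length_saturating (F : finFieldType) (L : fieldExtType F)
    (k rho n : nat) : Prop :=
  has_rank_saturating_system L k rho n /\
  forall m, has_rank_saturating_system L k rho m -> (n <= m)%N.

Definition prime_power (q : nat) : Prop :=
  exists p e : nat, [/\ prime p, (0 < e)%N & q = (p ^ e)%N].

(* Main.v *)
From HB Require Import structures.
Require Import Defs.
From mathcomp Require Import all_boot all_order all_algebra all_field.
From mathcomp Require Import fingroup cyclic.
From mathcomp Require Import zify ring.

(** Let [q = #|F|] and let [K] be the subfield of order [q^r] of [L]. A scattered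
    [F]-subspace [U] of [K^3] of dimension [r + 2] (every [K]-point has weight at
    most one) is rank-2-saturating over [L]: since [L] is quadratic over [K], each
    point of [PG(2, L)] lies on a line defined over [K], and that line meets [U] in
    dimension at least [2], hence in two distinct points. Conversely, counting the
    planes of [U] up to [GL_2(F)] shows that no shorter system saturates.

    It remains to find scattered subspaces. Identify [K^3] with the field of order
    [q^(3 r)] and let [T] be its subfield of order [q^3].
    - [r = 1 mod 3]: extend scattered [T]-subspaces greedily; translations by [F] act
      freely on the reasons why an extension is bad, which leaves room up to dimension
      [r + 2].
    - [r = 2 t]: take the graph [x + w f(x)], where [x] ranges over the field of order
      [q^(3 t)], [w] generates [K] over its subfield of order [q^t], and [f] is an
      irreducible semilinear map.
    - [r] prime to the order of [GL_2(F)] (cases (b) and (e)): take the triples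
      [(y + b, y^q, y^(q^2) + a)] with [y] in [K] and [a], [b] in [F]. A scalar [l]
      violating scatteredness satisfies [l^q = M(l)] for a Moebius map [M] over [F];
      as the order of [M] is prime to [r], this forces [l] into [F].
    - [r = 5], [q = p^e] with [p <= 5] and [e] prime to [15]: take [T + T g + F z] for
      suitable [g] and [z]. A scalar violating scatteredness is a common zero over [F]
      of three quadrics in [PG(3, q)] with coefficients in [F_p]; the points where these
      meet have degree [3] or [5] over [F_p], so none is rational over [F]. *)

Set Implicit Arguments.
Unset Strict Implicit.
Unset Printing Implicit Defensive.

Import GRing.Theory.
Local Open Scope ring_scope.

(** * Fixed fields of iterated endomorphisms *)

Section IterMorphism.

Variables (R : nzRingType) (d : nat) (sigma : {rmorphism R -> R}).

Fact iter_is_zmod_morphism : zmod_morphism (iter d sigma).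
Proof. by move=> x y; elim: d => //= n ->; rewrite rmorphB. Qed.

Fact iter_is_monoid_morphism : monoid_morphism (iter d sigma).
Proof. by split=> [|x y]; elim: d => //= n ->; rewrite (rmorph1, rmorphM). Qed.

HB.instance Definition _ :=
  GRing.isZmodMorphism.Build R R (iter d sigma) iter_is_zmod_morphism.
HB.instance Definition _ :=
  GRing.isMonoidMorphism.Build R R (iter d sigma) iter_is_monoid_morphism.

End IterMorphism.

Section FixedField.

Variables (M : fieldType) (sigma : {rmorphism M -> M}).
Implicit Types (d e k n : nat) (x y : M) (P : {poly M}) (s : seq M).

Definition fixf d : {pred M} := fun x => iter d sigma x == x.

Lemma fixfE d x : (x \in fixf d) = (iter d sigma x == x).
Proof. by []. Qed.

Lemma fixfP d x : reflect (iter d sigma x = x) (x \in fixf d).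
Proof. exact: eqP. Qed.

Fact fixf_divring_closed d : divring_closed (fixf d).
Proof.
by split=> [|x y|x y]; rewrite !fixfE ?rmorph1 //= => /eqP Ex /eqP Ey;
  rewrite (rmorphB, fmorph_div) /= Ex Ey.
Qed.

HB.instance Definition _ d :=
  GRing.isDivringClosed.Build M (fixf d) (fixf_divring_closed d).

Lemma fixf_iter k d x : x \in fixf d -> iter k sigma x \in fixf d.
Proof. by move/fixfP=> Ex; rewrite fixfE -iterD addnC iterD Ex. Qed.

Lemma iter_fixf_muln d k x : x \in fixf d -> iter (d * k) sigma x = x.
Proof.
by move/fixfP=> Ex; elim: k => [|k IHk]; rewrite ?muln0 // mulnS iterD IHk.
Qed.

Lemma fixf_dvdn d e x : (d %| e)%N -> x \in fixf d -> x \in fixf e.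
Proof. by case/dvdnP=> k -> dx; apply/fixfP; rewrite mulnC iter_fixf_muln. Qed.

Lemma fixf_gcdn d e x : x \in fixf d -> x \in fixf e -> x \in fixf (gcdn d e).
Proof.
case: d => [|d] dx ex; first by rewrite gcd0n.
have [km kn E _] := egcdnP e (ltn0Sn d).
apply/fixfP; rewrite -{2}(iter_fixf_muln km dx) mulnC E addnC iterD mulnC.
by rewrite iter_fixf_muln.
Qed.

Lemma fixf_coprime d e x :
  coprime d e -> x \in fixf d -> x \in fixf e -> x \in fixf 1.
Proof. by move/eqP<-; apply: fixf_gcdn. Qed.

Lemma iter_fixf_inj d n x : prime n -> x \in fixf (d * n) -> x \notin fixf d ->
  {in gtn n &, injective (fun i => iter (d * i) sigma x)}.
Proof.
move=> n_pr dn_x d'x i j; wlog le_ij : i j / (i <= j)%N.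
  by move=> IH ni nj E; case/orP: (leq_total i j) => h; [|apply/esym]; apply: IH.
rewrite !inE => _ lt_jn E; apply: contraNeq d'x => ne_ij.
have ji_x : x \in fixf (d * (j - i)).
  apply/fixfP/esym/(fmorph_inj (iter (d * i) sigma)).
  by rewrite /= -iterD -mulnDr subnKC.
rewrite -[d]muln1 -(eqP (_ : coprime (j - i) n)) ?muln_gcdr ?fixf_gcdn //.
by rewrite coprime_sym prime_coprime // gtnNdvd; lia.
Qed.

Lemma horner_fixf d P x :
  P \is a polyOver (fixf d) -> P.[iter d sigma x] = iter d sigma P.[x].
Proof.
move/polyOverP=> dP; rewrite -horner_map map_poly_id // => _ /(nthP 0)[i _ <-].
exact/fixfP.
Qed.

Lemma polyOver_fixf_eq0 d n x P :
    prime n -> x \in fixf (d * n) -> x \notin fixf d ->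
    P \is a polyOver (fixf d) -> (size P <= n)%N -> P.[x] = 0 -> P = 0.
Proof.
move=> n_pr dn_x d'x dP leP Px; apply: contraTeq leP => nzP; rewrite -ltnNge.
pose s := [seq iter (d * i) sigma x | i <- iota 0 n].
have <- : size s = n by rewrite size_map size_iota.
apply: max_poly_roots => //.
  apply/allP=> _ /mapP[i _ ->]; rewrite rootE horner_fixf ?Px ?rmorph0 //.
  by by apply: polyOverS dP => y; apply/fixf_dvdn/dvdn_mulr.
rewrite map_inj_in_uniq ?iota_uniq // => i j; rewrite !mem_iota.
exact: iter_fixf_inj.
Qed.

Definition power_comb n x (a : 'I_n -> M) := \sum_(j < n) a j * x ^+ j.

Lemma power_comb_eq0 d n x (a : 'I_n -> M) :
    prime n -> x \in fixf (d * n) -> x \notin fixf d ->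
    (forall j, a j \in fixf d) -> power_comb x a = 0 -> forall j, a j = 0.
Proof.
move=> n_pr dn_x d'x da a0 j; pose b := nth 0 (fgraph (finfun a)).
have bE (l : 'I_n) : b l = a l by rewrite /b nth_fgraph_ord ffunE.
have /polyP/(_ j) : \poly_(l < n) b l = 0.
  apply: polyOver_fixf_eq0 n_pr dn_x d'x _ (size_poly _ _) _.
    by apply: polyOver_poly => l lt_ln; rewrite -[l]/(val (Ordinal lt_ln)) bE.
  by rewrite horner_poly -[RHS]a0; apply: eq_bigr => l _; rewrite bE.
by rewrite coef_poly ltn_ord bE coef0.
Qed.

Lemma fixf_lin_indep d n x s :
    prime n -> x \in fixf (d * n) -> x \notin fixf d -> (size s <= n)%N ->
    {subset s <= fixf d} -> \sum_(j < n) s`_j * x ^+ j = 0 -> all (pred1 0) s.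
Proof.
move=> n_pr dn_x d'x le_sn ds /(power_comb_eq0 n_pr dn_x d'x) s0.
apply/(all_nthP 0)=> j lt_js /=; have lt_jn := leq_trans lt_js le_sn.
rewrite (s0 _ (Ordinal lt_jn)) // => l.
have [lt_ls | /(nth_default 0)->] := ltnP l (size s).
  exact/ds/mem_nth.
exact: rpred0.
Qed.

Lemma fixf_lin_indep3 d x a0 a1 a2 :
    x \in fixf (d * 3) -> x \notin fixf d ->
    a0 \in fixf d -> a1 \in fixf d -> a2 \in fixf d ->
    a0 + a1 * x + a2 * x ^+ 2 = 0 ->
  [/\ a0 = 0, a1 = 0 & a2 = 0].
Proof.
move=> d3x d'x da0 da1 da2 E.
have /and4P[/eqP-> /eqP-> /eqP-> _] : all (pred1 0) [:: a0; a1; a2]; last by [].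
apply: (fixf_lin_indep (n := 3) _ d3x d'x) => //.
  by move=> y; rewrite !inE => /or3P[] /eqP->.
by rewrite !big_ord_recl big_ord0 /bump /= -[RHS]E; ring.
Qed.

Lemma power_combB n x (a b : 'I_n -> M) :
  power_comb x a - power_comb x b = power_comb x (fun j => a j - b j).
Proof. by rewrite -sumrB; apply: eq_bigr => j _; rewrite mulrBl. Qed.

End FixedField.

Arguments fixfP {M sigma d x}.

Lemma power_comb_onto (M : finFieldType) (sigma : {rmorphism M -> M}) d n x y :
    prime n -> x \in fixf sigma (d * n) -> x \notin fixf sigma d ->
    #|fixf sigma (d * n)| = (#|fixf sigma d| ^ n)%N -> y \in fixf sigma (d * n) ->
  exists2 a : 'I_n -> M, forall j, a j \in fixf sigma d & y = power_comb x a.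
Proof.
move=> n_pr dn_x d'x card_dn dn_y.
pose A : {pred {ffun 'I_n -> M}} := ffun_on (fixf sigma d).
have comb_inj : {in A &, injective (fun a : {ffun 'I_n -> M} => power_comb x a)}.
  move=> a b /ffun_onP da /ffun_onP db /eqP; rewrite -subr_eq0 power_combB => /eqP ab0.
  apply/ffunP=> j; apply/subr0_eq/(power_comb_eq0 n_pr dn_x d'x _ ab0) => l.
  by rewrite rpredB ?da ?db.
have : y \in [set power_comb x a | a : {ffun 'I_n -> M} in A].
  suffices ->: [set power_comb x a | a : {ffun 'I_n -> M} in A]
    = [set z in fixf sigma (d * n)].
    by rewrite inE.
  apply/eqP; rewrite eqEcard card_in_imset // cardsE card_dn card_ffun_on card_ord.
  rewrite leqnn andbT.
  apply/subsetP=> _ /imsetP[a /ffun_onP da ->]; rewrite inE rpred_sum // => j _.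
  by rewrite rpredM ?rpredX // (fixf_dvdn (dvdn_mulr n (dvdnn d))).
by case/imsetP=> a /ffun_onP da ->; exists a.
Qed.

(** * The Frobenius endomorphism over a finite field *)

Section Frobenius.

Variables (F : finFieldType) (R : comNzRingType) (f : {rmorphism F -> R}).
Local Notation q := #|F|.

Definition frobenius of {rmorphism F -> R} := fun x : R => x ^+ q.

Lemma card_finField_pnat : [pchar R].-nat q.
Proof.
have [p p_pr pF] := finPcharP F.
by rewrite (card_pprimeChar pF) pnatX pnatE // (rmorph_pchar f pF).
Qed.

Fact frobenius_is_zmod_morphism : zmod_morphism (frobenius f).
Proof.
move=> x y; apply: (addIr (y ^+ q)).
by rewrite /frobenius -(exprDn_pchar _ _ card_finField_pnat) !subrK.
Qed.

Fact frobenius_is_monoid_morphism : monoid_morphism (frobenius f).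
Proof. by split=> [|x y]; rewrite /frobenius (expr1n, exprMn). Qed.

HB.instance Definition _ :=
  GRing.isZmodMorphism.Build R R (frobenius f) frobenius_is_zmod_morphism.
HB.instance Definition _ :=
  GRing.isMonoidMorphism.Build R R (frobenius f) frobenius_is_monoid_morphism.

Lemma iter_frobenius d x : iter d (frobenius f) x = x ^+ (q ^ d).
Proof. by elim: d => // d IHd; rewrite iterS IHd /frobenius -exprM -expnSr. Qed.

Lemma natr_card_finField : q%:R = 0 :> R.
Proof. by rewrite -(rmorph_nat f) -FinRing.zmodXgE -cardsT expg_cardG ?inE ?rmorph0. Qed.

End Frobenius.

Lemma fixf_frobenius1 (F : finFieldType) (M : fieldType) (f : {rmorphism F -> M}) x :
  x \in fixf (frobenius f) 1 -> exists a, x = f a.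
Proof.
move=> /eqP Fx.
have /(congr1 (fun P => (map_poly f P).[x])) := finField_genPoly F.
rewrite rmorphB /= map_polyXn map_polyX !hornerE [x ^+ _]Fx subrr rmorph_prod.
rewrite horner_prod => /esym/eqP; rewrite prodf_seq_eq0 => /hasP[a _ /andP[_]].
by rewrite /= rmorphB /= map_polyX map_polyC !hornerE subr_eq0 => /eqP; exists a.
Qed.

Lemma fixf_frobenius_morph (F : finFieldType) (L M : fieldType)
    (f : {rmorphism F -> L}) (i : {rmorphism L -> M}) (g : {rmorphism F -> M}) d x :
  (i x \in fixf (frobenius g) d) = (x \in fixf (frobenius f) d).
Proof. by rewrite !fixfE !iter_frobenius -rmorphXn fmorph_eq. Qed.

Lemma dvdp_XnsubX (R : idomainType) q d e :
  (0 < q)%N -> (d %| e)%N -> ('X^(q ^ d) - 'X : {poly R}) %| 'X^(q ^ e) - 'X.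
Proof.
move=> q_gt0 /dvdnP[k ->].
have E n : 'X^(q ^ n) - 'X = 'X * ('X^((q ^ n).-1) - 1) :> {poly R}.
  by rewrite mulrBr mulr1 -exprS prednK // expn_gt0 q_gt0.
rewrite !E dvdp_mul // mulnC expnM (predn_exp (q ^ d)) exprM [X in _ %| X]subrX1.
exact: dvdp_mulr.
Qed.

Lemma size_XnsubX (R : nzRingType) n :
  (1 < n)%N -> size ('X^n - 'X : {poly R}) = n.+1.
Proof. by move=> n_gt1; rewrite size_polyDl size_polyXn // size_polyN size_polyX. Qed.

Section CardFixed.

Variables (F M : finFieldType) (f : {rmorphism F -> M}).
Local Notation q := #|F|.
Local Notation Fix := (fixf (frobenius f)).

Lemma card_fixf_frobenius d (s : seq M) : (0 < d)%N ->
  'X^(q ^ d) - 'X %| \prod_(z <- s) ('X - z%:P) -> #|Fix d| = (q ^ d)%N.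
Proof.
move=> d_gt0; have qd_gt1 : (1 < q ^ d)%N.
  by rewrite -(exp1n d) ltn_exp2r ?finNzRing_gt1.
case/dvdp_prod_XsubC=> m; set t := mask m s => Et.
have t_uniq : uniq t.
  rewrite -separable_prod_XsubC -(eqp_separable Et) unlock derivB derivXn derivX.
  rewrite -mulr_natr natrX -polyC_natr (natr_card_finField f) expr0n gtn_eqF //.
  rewrite mulr0 add0r -[- 1 in X in coprimep _ X]scaleN1r.
  by rewrite coprimepZr ?oppr_eq0 ?oner_eq0 ?coprimep1.
transitivity (size t).
  rewrite -(card_uniqP t_uniq); apply: eq_card => x.
  by rewrite -root_prod_XsubC -(eqp_root Et) rootE !hornerE subr_eq0 fixfE iter_frobenius.
by apply: succn_inj; rewrite -(size_prod_XsubC _ id) -(eqp_size Et) size_XnsubX.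
Qed.

Lemma exists_fixf_diff d e : #|Fix d| = (q ^ d)%N -> #|Fix e| = (q ^ e)%N ->
  (d < e)%N -> exists2 x, x \in Fix e & x \notin Fix d.
Proof.
move=> card_d card_e lt_de; apply/subsetPn/negP=> /subset_leq_card.
by rewrite card_d card_e leq_exp2l ?finNzRing_gt1 // leqNgt lt_de.
Qed.

End CardFixed.

Lemma exists_split_ext (F : finFieldType) (L : fieldExtType F) (P : {poly L}) :
  P != 0 -> exists (M : finFieldType) (i : {rmorphism L -> M}) (zs : seq M),
    map_poly i P %= \prod_(z <- zs) ('X - z%:P).
Proof.
move=> nzP; have [L' [zs Dzs _]] := @FinSplittingFieldFor (FinFieldExtType L) P nzP.
by exists (FinFieldExtType L'), (in_alg L' : {rmorphism L -> L'}), zs.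
Qed.

Lemma exists_fixf_ext (F : finFieldType) (L : fieldExtType F) D (P : {poly L}) :
    (0 < D)%N -> P != 0 ->
  exists (M : finFieldType) (i : {rmorphism L -> M}) (zs : seq M),
    map_poly i P %| \prod_(z <- zs) ('X - z%:P)
    /\ forall d, (d %| D)%N ->
         #|fixf (frobenius (i \o in_alg L)) d| = (#|F| ^ d)%N.
Proof.
move=> D_gt0 nzP; set q := #|F|; have q_gt1 : (1 < q)%N := finNzRing_gt1 F.
have qD_gt1 : (1 < q ^ D)%N by rewrite -(exp1n D) ltn_exp2r.
have [|M [i [zs Dzs]]] := @exists_split_ext F L (('X^(q ^ D) - 'X) * P).
  by rewrite mulf_neq0 // -size_poly_eq0 size_XnsubX.
move: Dzs; rewrite rmorphM rmorphB /= map_polyXn map_polyX => Dzs.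
exists M, i, zs; rewrite -(eqp_dvdr _ Dzs) dvdp_mull //; split=> // d dvD.
apply: (@card_fixf_frobenius _ _ _ _ zs); first exact: dvdn_gt0 dvD.
by rewrite -(eqp_dvdr _ Dzs) dvdp_mulr // dvdp_XnsubX // ltnW.
Qed.

Lemma exists_card_fixf_ext (F : finFieldType) (L : fieldExtType F) D : (0 < D)%N ->
  exists (M : finFieldType) (i : {rmorphism L -> M}),
    forall d, (d %| D)%N -> #|fixf (frobenius (i \o in_alg L)) d| = (#|F| ^ d)%N.
Proof.
move=> D_gt0; have [M [i [_ [_ card_d]]]] := exists_fixf_ext D_gt0 (oner_neq0 {poly L}).
by exists M, i.
Qed.

(** * The length of a saturating system *)

Lemma row_free_factor (K : fieldType) m n (C : 'M[K]_(m, n)) :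
  (m <= n)%N -> exists D : 'M_m, exists2 C', row_free C' & C = D *m C'.
Proof.
move=> le_mn; exists (col_ebase C *m pid_mx (\rank C)), (pid_mx m *m row_ebase C).
  by rewrite /row_free mxrankMfree ?row_free_unit ?row_ebase_unit // rank_pid_mx.
rewrite mulmxA -(mulmxA (col_ebase C)) mul_pid_mx.
by rewrite (minn_idPl (rank_leq_row C)) (minn_idPr (rank_leq_row C)) mulmx_ebase.
Qed.

(* [GL_m(F)] acts freely on the factorizations [x = a C B] with [C] row free. *)
Lemma card_factorizations (F E : finFieldType) (i : {rmorphism F -> E}) m n k
    (B : 'M[E]_(n, k)) :
    (m < n)%N ->
    (forall x, exists (a : 'rV_m.+1) (C : 'M_(m.+1, n)), x = a *m map_mx i C *m B) ->
  (#|E| ^ k * #|'GL_m.+1[F]%g| <= #|E| ^ m.+1 * #|F| ^ (m.+1 * n))%N.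
Proof.
move=> lt_mn facB.
have free_facB (x : 'rV[E]_k) : exists t : 'rV[E]_m.+1 * 'M[F]_(m.+1, n),
    row_free t.2 /\ x = t.1 *m map_mx i t.2 *m B.
  have [a [C ->]] := facB x; have [D [C' freeC' ->]] := row_free_factor C lt_mn.
  by exists (a *m map_mx i D, C'); rewrite map_mxM !mulmxA.
have [t tP] := fin_all_exists free_facB.
pose act (w : 'rV[E]_k * {'GL_m.+1[F]}) :=
  ((t w.1).1 *m invmx (map_mx i (GLval w.2)), GLval w.2 *m (t w.1).2).
have actK w : (act w).1 *m map_mx i (act w).2 *m B = w.1.
  rewrite /= map_mxM mulmxA mulmxKV; first by have [_ <-] := tP w.1.
  by rewrite map_unitmx; exact: (GL_unitmx w.2).
have act_inj : injective act.
  move=> [x g] [x' g'] eq_act.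
  have /= eq_x : (x, g).1 = (x', g').1 by rewrite -actK eq_act actK.
  move: eq_act; rewrite -eq_x => -[_ /(row_free_inj _) eq_g].
  by congr (_, _); apply/val_inj/eq_g; have [] := tP x.
have := leq_card _ act_inj.
by rewrite !card_prod !card_mx !mul1n -[#|{: {'GL_m.+1[F]}}|]cardsT.
Qed.

Lemma card_finvect (F : finFieldType) (vT : vectType F) :
  #|finvect_type vT| = (#|F| ^ \dim {:vT})%N.
Proof.
have := card_vspacef (Vector.class (finvect_type vT : vectType F)).
by rewrite (card_vspace (cvT := Vector.class (finvect_type vT : vectType F))).
Qed.

Section Saturating.

Variables (F : finFieldType) (L : fieldExtType F) (k : nat).
Local Notation V := {ffun 'I_k -> L}.
Implicit Types (U : {vspace V}) (x : 'rV[L]_k).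

Lemma Lrow_inj : injective (@Lrow F L k).
Proof. by move=> u v /rowP E; apply/ffunP=> i; have := E i; rewrite !mxE. Qed.

Lemma Lrow_sum n (c : 'I_n -> F) (u : 'I_n -> V) :
  Lrow (\sum_j c j *: u j) = \sum_j in_alg L (c j) *: Lrow (u j).
Proof.
apply/rowP=> l; rewrite !mxE sum_ffunE summxE; apply: eq_bigr => j _.
by rewrite !mxE ffunE mulr_algl.
Qed.

Lemma saturates_span t U x : saturates t (linear_set U) ->
  exists (a : 'I_t.+1 -> L) (u : 'I_t.+1 -> V),
    (forall j, u j \in U) /\ x = \sum_j a j *: Lrow (u j).
Proof.
move=> satU; have [-> | nz_x] := eqVneq x 0.
  exists (fun=> 0), (fun=> 0); split=> [j|]; rewrite ?mem0v // big1 // => j _.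
  by rewrite scale0r.
have [|Ps [_ LPs]] := satU <[x]>%VS; first by rewrite /is_point dim_vline nz_x.
rewrite big_tuple -memvE => /memv_sumP[y yPs ->].
have /fin_all_exists2[u uU yE] : forall j, exists2 u, u \in U & y j \in <[Lrow u]>%VS.
  move=> j; have [u [uU _ Pj]] := LPs _ (mem_tnth j Ps).
  by exists u; rewrite // -Pj yPs.
have /fin_all_exists[a aE] : forall j, exists a, y j = a *: Lrow (u j).
  by move=> j; apply/vlineP.
by exists a, u; split=> //; apply: eq_bigr.
Qed.

Lemma saturates_card t U : saturates t (linear_set U) ->
  (#|F| ^ (\dim {:L} * k) * #|'GL_t.+1[F]%g|
    <= #|F| ^ (\dim {:L} * t.+1 + t.+1 * maxn (\dim U) t.+1))%N.
Proof.
move=> satU; pose b := vbasis U; rewrite maxnE; set e := (t.+1 - \dim U)%N.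
pose B : 'M[L]_(\dim U + e, k) := col_mx (\matrix_j Lrow b`_j) 0.
have := @card_factorizations F (FinFieldExtType L) (in_alg L) t _ k B.
rewrite [#|{: FinFieldExtType L}|]card_finvect -!expnM expnD; apply; first by lia.
move=> x; have [a [u [uU ->]]] := saturates_span x satU.
exists (\row_j a j), (row_mx (\matrix_(j, l) coord b l (u j)) 0).
rewrite map_row_mx -mulmxA mul_row_col mulmx0 addr0 !mulmx_sum_row.
apply: eq_bigr => j _; rewrite mxE row_mul mulmx_sum_row {1}(coord_vbasis (uU j)).
by rewrite Lrow_sum; congr (_ *: _); apply: eq_bigr => l _; rewrite rowK !mxE.
Qed.

End Saturating.

Section PlaneLength.

Variables (F : finFieldType) (L : fieldExtType F) (r : nat).
Local Notation q := #|F|.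
Hypothesis dimL : \dim {:L} = (2 * r)%N.
Variable U : {vspace {ffun 'I_3 -> L}}.

Let q_gt1 : (1 < q)%N := finNzRing_gt1 F.

Lemma saturates0_dim : saturates 0 (linear_set U) -> (4 * r <= \dim U)%N.
Proof.
move=> /saturates_card; rewrite dimL => /(leq_trans (leq_pmulr _ (cardG_gt0 _))).
by rewrite leq_exp2l //; lia.
Qed.

Hypothesis r_gt0 : (0 < r)%N.

Lemma saturates1_dim : saturates 1 (linear_set U) -> (r + 2 <= \dim U)%N.
Proof.
move=> /saturates_card; rewrite dimL; apply: contraTT; rewrite -!ltnNge => ltU.
apply: (@leq_ltn_trans (q ^ (2 * r * 3) * q ^ 2)).
  by rewrite -expnD leq_exp2l //; lia.
rewrite ltn_pmul2l ?card_GL_2; last by rewrite expn_gt0 ltnW.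
rewrite -mulnA ltn_pmul2l; last exact: ltnW.
by rewrite leq_pmull // expn_gt0 -ltnS prednK ?q_gt1 // ltnW.
Qed.

End PlaneLength.

(** * Scattered subspaces saturate *)

Lemma exists_subv (K : fieldType) (vT : vectType K) (U : {vspace vT}) n :
  (n <= \dim U)%N -> exists2 W : {vspace vT}, (W <= U)%VS & \dim W = n.
Proof.
move=> le_nU; exists <<take n (vbasis U)>>%VS.
  by apply/span_subvP=> x /mem_take; apply: vbasis_mem.
have := basis_free (vbasisP U); rewrite -{1}(cat_take_drop n (vbasis U)).
by move=> /catl_free/eqP->; rewrite size_takel // size_tuple.
Qed.

Lemma dimv_leq_card (F : finFieldType) (vT : vectType F) (U : {vspace vT}) n
    (A : {pred finvect_type vT}) :
  {subset U <= A} -> (#|A| <= #|F| ^ n)%N -> (\dim U <= n)%N.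
Proof.
move=> sUA cardA; rewrite -(leq_exp2l _ _ (finNzRing_gt1 F)).
have <- : \dim {: subvs_of U} = \dim U by rewrite dimvf.
rewrite -card_finvect; apply: leq_trans cardA.
pose f (u : finvect_type (subvs_of U)) : finvect_type vT := vsval u.
have f_inj : injective f by move=> u v; apply: (@val_inj _ _ (subvs_of U)).
rewrite -(card_imset _ f_inj); apply/subset_leq_card/subsetP=> _ /imsetP[u _ ->].
exact/sUA/subvsP.
Qed.

Section FieldExtension.

Variables (F : finFieldType) (L : fieldExtType F).

Lemma card_fixf_fieldExt d : (d %| \dim {:L})%N ->
  #|(fixf (frobenius (in_alg L)) d : {pred FinFieldExtType L})| = (#|F| ^ d)%N.
Proof.
move=> dvd_d; have d_gt0 : (0 < d)%N by apply: dvdn_gt0 dvd_d; apply: adim_gt0.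
apply: (@card_fixf_frobenius F (FinFieldExtType L) (in_alg L) d
  (enum (finvect_type L))) => //.
rewrite big_enum -(finField_genPoly (FinFieldExtType L)).
rewrite [#|{: FinFieldExtType L}|]card_finvect dvdp_XnsubX //.
exact/ltnW/finNzRing_gt1.
Qed.

End FieldExtension.

Section Scattered.

Variables (F : finFieldType) (L : fieldExtType F) (k : nat).
Local Notation q := #|F|.
Local Notation Fix := (fixf (frobenius (in_alg L))).
Local Notation V := {ffun 'I_k -> L}.
Implicit Types (U : {vspace V}) (h u v : V).

Definition scattered U := forall u v c,
  u \in U -> v \in U -> u != 0 -> Lrow v = c *: Lrow u -> c \in Fix 1.

Definition defined_over r U := forall u j, u \in U -> u j \in Fix r.

Lemma Lrow_eq0 u : (Lrow u == 0) = (u == 0).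
Proof.
by rewrite -(inj_eq (@Lrow_inj _ _ _)); congr (_ == _); apply/rowP=> i; rewrite !mxE ffunE.
Qed.

Lemma scattered_submx U u v : scattered U -> u \in U -> v \in U -> u != 0 ->
  (Lrow v <= Lrow u)%MS -> v \in <[u]>%VS.
Proof.
move=> scU uU vU nz_u /sub_rVP[c Ev].
have [a Ec] := fixf_frobenius1 (scU u v c uU vU nz_u Ev).
apply/vlineP; exists a; apply/(@Lrow_inj _ _ _)/rowP=> j.
by rewrite Ev Ec !mxE ffunE mulr_algl.
Qed.

Definition dotv h u : L := \sum_j u j * h j.

Fact dotv_is_linear h : linear (dotv h).
Proof.
move=> a u v; rewrite /dotv scaler_sumr -big_split; apply: eq_bigr => j _ /=.
by rewrite !ffunE mulrDl scalerAl.
Qed.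

HB.instance Definition _ h := GRing.isLinear.Build F V L *:%R (dotv h) (dotv_is_linear h).

Lemma mulmx_Lrow_tr u h : Lrow u *m (Lrow h)^T = (dotv h u)%:M.
Proof.
by rewrite [LHS]mx11_scalar mxE; congr _%:M; apply: eq_bigr => j _; rewrite !mxE.
Qed.

Lemma exists_fixf_dotv0 r u : (r %| \dim {:L})%N -> (\dim {:L} < r * k)%N ->
  exists h, [/\ h != 0, forall j, h j \in Fix r & dotv h u = 0].
Proof.
move=> dvd_r lt_dim; pose Lf := FinFieldExtType L.
pose A : {pred {ffun 'I_k -> Lf}} := ffun_on (Fix r : {pred Lf}).
pose f (h : {ffun 'I_k -> Lf}) : Lf := dotv h u.
have : ~~ dinjectiveb f A.
  apply: contraL lt_dim => /dinjectiveP/leq_card_in; rewrite -leqNgt.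
  rewrite card_ffun_on card_ord card_fixf_fieldExt // -expnM [#|{: Lf}|]card_finvect.
  by rewrite leq_exp2l ?finNzRing_gt1.
case/dinjectivePn=> h /ffun_onP Ah [h' /andP[/= ne_hh' /ffun_onP Ah'] eq_f].
exists (h - h' : V); split=> [|j|]; first by rewrite subr_eq0 eq_sym.
  by rewrite !ffunE rpredB ?Ah ?Ah'.
apply/eqP; rewrite -(subrr (f h)) {2}eq_f -sumrB; apply/eqP/eq_bigr=> j _.
by rewrite !ffunE mulrBr.
Qed.

Lemma exists_free_dotv0 r U h : (r %| \dim {:L})%N -> (r + 2 <= \dim U)%N ->
    defined_over r U -> (forall j, h j \in Fix r) ->
  exists u v, [/\ u \in U, v \in U, u != 0, v \notin <[u]>%VS
                & dotv h u = 0 /\ dotv h v = 0].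
Proof.
move=> dvd_r dimU rU rh; pose phi := linfun (dotv h).
have dim_im : (\dim (phi @: U) <= r)%N.
  apply: (@dimv_leq_card F L _ r (Fix r)); last by rewrite card_fixf_fieldExt.
  move=> _ /memv_imgP[u uU ->]; rewrite lfunE /= rpred_sum // => j _.
  by rewrite rpredM ?rh ?rU.
have := limg_ker_dim phi U; set B := (U :&: lker phi)%VS => dimB.
have dimB_ge2 : (1 < \dim B)%N.
  rewrite -(leq_add2r (\dim (phi @: U))) dimB; apply: leq_trans dimU.
  by rewrite addnC leq_add2r.
have nz_u : vpick B != 0 by rewrite vpick0 -dimv_eq0; lia.
have /subvPn[v vB u'v] : ~~ (B <= <[vpick B]>)%VS.
  by apply: contraL dimB_ge2 => /dimvS; rewrite dim_vline nz_u -leqNgt.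
exists (vpick B), v; have := memv_pick B; move: vB.
by rewrite !memv_cap !memv_ker !lfunE /= => /andP[vU /eqP hv] /andP[uU /eqP hu].
Qed.

End Scattered.

Section ScatteredPlane.

Variables (F : finFieldType) (L : fieldExtType F) (r : nat).
Hypotheses (r_gt0 : (0 < r)%N) (dimL : \dim {:L} = (2 * r)%N).
Variable U : {vspace {ffun 'I_3 -> L}}.
Hypotheses (rU : defined_over r U) (scU : scattered U).

Lemma scattered_line_sub (h u v : {ffun 'I_3 -> L}) (x : 'rV[L]_3) :
    h != 0 -> u \in U -> v \in U -> u != 0 -> v \notin <[u]>%VS ->
    dotv h u = 0 -> dotv h v = 0 -> x *m (Lrow h)^T = 0 ->
  (x <= Lrow u + Lrow v)%MS.
Proof.
move=> nz_h uU vU nz_u u'v hu hv hx; set H := (Lrow h)^T.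
have /mxrank_leqif_sup : (Lrow u + Lrow v <= kermx H)%MS.
  by rewrite addsmx_sub !sub_kermx !mulmx_Lrow_tr hu hv !raddf0 eqxx.
case=> [_] sub_ker; apply: submx_trans (_ : (kermx H <= _)%MS).
  by rewrite sub_kermx hx.
rewrite -sub_ker eqn_leq mxrankS -?sub_kermx //=; last first.
  by rewrite addsmx_sub !sub_kermx !mulmx_Lrow_tr hu hv !raddf0 eqxx.
have : (Lrow u < Lrow u + Lrow v)%MS.
  rewrite /ltmx addsmxSl addsmx_sub submx_refl /=.
  by apply: contra u'v; apply: scattered_submx scU uU vU nz_u.
rewrite ltmxErank mxrank_ker mxrank_tr !rank_rV !Lrow_eq0 nz_u nz_h.
by case/andP.
Qed.

Hypothesis dimU : (r + 2 <= \dim U)%N.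

Lemma scattered_saturates : saturates 1 (linear_set U).
Proof.
move=> Q dimQ; have nzQ : Q != 0%VS by rewrite -dimv_eq0 dimQ.
pose x := vpick Q; have {nzQ} nz_x : x != 0 by rewrite vpick0.
have -> : Q = <[x]>%VS.
  by apply/esym/eqP; rewrite eqEdim -memvE memv_pick dim_vline nz_x dimQ.
pose y : {ffun 'I_3 -> L} := [ffun j => x 0 j].
have Ex : x = Lrow y by apply/rowP=> j; rewrite mxE ffunE.
have dvd_r : (r %| \dim {:L})%N by rewrite dimL dvdn_mull.
have [|h [nz_h rh hy]] := exists_fixf_dotv0 y dvd_r; first by rewrite dimL; lia.
have [u [v [uU vU nz_u u'v [hu hv]]]] := exists_free_dotv0 dvd_r dimU rU rh.
have sub_x : (x <= Lrow u + Lrow v)%MS.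
  apply: scattered_line_sub nz_h uU vU nz_u u'v hu hv _.
  by rewrite Ex mulmx_Lrow_tr hy raddf0.
exists [tuple <[Lrow u]>%VS; <[Lrow v]>%VS]; split.
- rewrite /= inE andbT; apply: contraNneq u'v => Euv.
  apply: scattered_submx scU uU vU nz_u _; apply/sub_rVP/vlineP.
  by rewrite Euv memv_line.
- have nz_v : v != 0 by apply: contraNneq u'v => ->; apply: mem0v.
  by move=> P; rewrite !inE => /orP[]/eqP->; [exists u|exists v].
rewrite /= big_cons big_seq1 -memvE; case/sub_addsmxP: sub_x => D ->.
by rewrite (mx11_scalar D.1) (mx11_scalar D.2) !mul_scalar_mx memv_add ?memvZ ?memv_line.
Qed.

End ScatteredPlane.

Lemma saturates_Lspan (F : finFieldType) (L : fieldExtType F) k t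
    (U : {vspace {ffun 'I_k -> L}}) :
  saturates t (linear_set U) -> Lspan U = fullv.
Proof.
move=> satU; apply/eqP; rewrite eqEsubv subvf /=; apply/subvP=> x _.
have [a [u [uU ->]]] := saturates_span x satU; apply: memv_suml => j _.
exact/memvZ/(Lspan_subP U _ (subvv _)).
Qed.

Theorem scattered_min_length (F : finFieldType) (L : fieldExtType F) r
    (U : {vspace {ffun 'I_3 -> L}}) :
    (0 < r)%N -> \dim {:L} = (2 * r)%N ->
    defined_over r U -> scattered U -> (r + 2 <= \dim U)%N ->
  min_length_saturating L 3 2 (r + 2).
Proof.
move=> r_gt0 dimL rU scU /exists_subv[W /subvP sWU dimW].
split=> [|n [U' [[<- _] [_ [sat1 _]]]]]; last exact: (saturates1_dim dimL r_gt0 sat1).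
have satW : saturates 1 (linear_set W).
  apply: (scattered_saturates r_gt0 dimL); rewrite ?dimW //.
    by move=> u j /sWU; apply: rU.
  by move=> u v c /sWU uU /sWU vU; apply: scU.
exists W; split; first by rewrite /is_system dimW (saturates_Lspan satW).
split=> //; split=> // -[|//] /(saturates0_dim dimL); rewrite dimW; lia.
Qed.

(** * Scattered subspaces of an extension field *)

Lemma submod_closed_vspace (F : finFieldType) (vT : vectType F) (S : {pred vT}) :
  submod_closed S -> exists U : {vspace vT}, U =i S.
Proof.
case=> S0 Slin; pose s := enum (S : {pred finvect_type vT}).
have sE (u : vT) : (u \in (s : seq vT)) = (u \in S).
  exact: (@mem_enum (finvect_type vT)).
exists <<(s : seq vT)>>%VS => u; apply/idP/idP => [|uS]; last by rewrite memv_span ?sE.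
move/(@coord_span _ _ _ (in_tuple (s : seq vT)))->.
elim/big_rec: _ => // j v _ vS; apply: Slin => //.
by rewrite -sE mem_nth.
Qed.

Lemma fixf_frobenius_onto (F : finFieldType) (L : fieldExtType F) (M : finFieldType)
    (i : {rmorphism L -> M}) (g : {rmorphism F -> M}) d y :
    (d %| \dim {:L})%N -> #|fixf (frobenius g) d| = (#|F| ^ d)%N ->
    y \in fixf (frobenius g) d ->
  exists2 x, x \in fixf (frobenius (in_alg L)) d & y = i x.
Proof.
move=> dvd_d card_d dy; pose A : {pred FinFieldExtType L} := fixf (frobenius (in_alg L)) d.
pose h : FinFieldExtType L -> M := i; have h_inj : injective h by apply: fmorph_inj.
have : y \in [set h x | x in A].
  suffices ->: [set h x | x in A] = [set z in fixf (frobenius g) d] by rewrite inE.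
  apply/eqP; rewrite eqEcard card_imset // cardsE card_d card_fixf_fieldExt // leqnn andbT.
  by apply/subsetP=> _ /imsetP[x Ax ->]; rewrite inE (fixf_frobenius_morph (in_alg L)).
by case/imsetP=> x Ax ->; exists x.
Qed.

Section FieldSubspaces.

Variables (M : finFieldType) (sigma : {rmorphism M -> M}).
Local Notation Fix := (fixf sigma).
Implicit Types (d r : nat) (W : {set M}).

Definition fixf_submod d W :=
  [/\ 0 \in W, {in W &, forall x y, x + y \in W}
    & {in Fix d & W, forall a x, a * x \in W}].

Definition fixf_scattered r W :=
  {in Fix r & W, forall a x, x != 0 -> a * x \in W -> a \in Fix 1}.

Definition scattered_submod d r W :=
  [/\ fixf_submod d W, {subset W <= Fix (r * 3)} & fixf_scattered r W].

Lemma imset_fixf_submod d e (phi : M -> M) : (d %| e)%N ->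
    {in Fix e &, forall x y, phi (x + y) = phi x + phi y} ->
    {in Fix d & Fix e, forall a x, phi (a * x) = a * phi x} ->
  fixf_submod d [set phi x | x in Fix e].
Proof.
move=> dvd_de phiD phiZ; split.
- apply/imsetP; exists 0; first exact: rpred0.
  by rewrite -[in RHS](mul0r 0) phiZ ?rpred0 // mul0r.
- move=> _ _ /imsetP[x ex ->] /imsetP[y ey ->].
  by apply/imsetP; exists (x + y); rewrite ?phiD ?rpredD.
move=> a _ da /imsetP[x ex ->].
by apply/imsetP; exists (a * x); rewrite ?phiZ // rpredM ?(fixf_dvdn dvd_de da).
Qed.

End FieldSubspaces.

Section Coordinates.

Variables (F : finFieldType) (L : fieldExtType F) (M : finFieldType).
Variables (i : {rmorphism L -> M}) (r k : nat) (c : M).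
Local Notation q := #|F|.
Local Notation V := {ffun 'I_k -> L}.
Local Notation FixL := (fixf (frobenius (in_alg L))).
Local Notation FixM := (fixf (frobenius (i \o in_alg L))).
Hypotheses (k_pr : prime k) (dvd_r : (r %| \dim {:L})%N).
Hypotheses (card_r : #|FixM r| = (q ^ r)%N) (card_rk : #|FixM (r * k)| = (q ^ (r * k))%N).
Hypotheses (rk_c : c \in FixM (r * k)) (r'c : c \notin FixM r).

Definition coord_comb (u : V) : M := power_comb c (i \o u).

Lemma coord_comb_eq0 (u : V) : (forall j, u j \in FixL r) -> coord_comb u = 0 -> u = 0.
Proof.
move=> ru u0; apply/ffunP=> j; rewrite ffunE; apply/(fmorph_inj i).
rewrite rmorph0; apply: power_comb_eq0 k_pr rk_c r'c _ u0 j => l.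
by rewrite (fixf_frobenius_morph (in_alg L)).
Qed.

Lemma coord_comb_onto y : y \in FixM (r * k) ->
  exists2 u : V, forall j, u j \in FixL r & y = coord_comb u.
Proof.
move=> rk_y; have [|a ra ->] := power_comb_onto k_pr rk_c r'c _ rk_y.
  by rewrite card_rk card_r expnM.
have /fin_all_exists2[u ru ua] : forall j : 'I_k, exists2 x, x \in FixL r & a j = i x.
  by move=> j; apply: fixf_frobenius_onto dvd_r card_r (ra j).
exists [ffun j => u j] => [j|]; first by rewrite ffunE.
by apply: eq_bigr => j _; rewrite /= ffunE ua.
Qed.

Lemma exists_scattered_vspace (W : {set M}) :
    fixf_submod (frobenius (i \o in_alg L)) 1 W -> {subset W <= FixM (r * k)} ->
    fixf_scattered (frobenius (i \o in_alg L)) r W ->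
  exists U : {vspace V}, [/\ defined_over r U, scattered U & (#|W| <= q ^ \dim U)%N].
Proof.
move=> [W0 WD WZ] rkW scW.
pose S := [pred u : V | [forall j, u j \in FixL r] && (coord_comb u \in W)].
have [|U US] := @submod_closed_vspace F _ S.
  split=> [|a u v]; rewrite !inE.
    apply/andP; split; first by apply/forallP=> j; rewrite ffunE rpred0.
    by rewrite /coord_comb /power_comb big1 // => j _; rewrite /= ffunE rmorph0 mul0r.
  case/andP=> /forallP ru uW /andP[/forallP rv vW].
  have Fa : in_alg L a \in FixL 1.
    by rewrite fixfE /= /frobenius -in_algE -rmorphXn /= expf_card.
  apply/andP; split.
    apply/forallP=> j; rewrite !ffunE -mulr_algl rpredD ?rpredM //.
    exact: fixf_dvdn (dvd1n r) Fa.
  have -> : coord_comb (a *: u + v) = i (in_alg L a) * coord_comb u + coord_comb v.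
    rewrite /coord_comb /power_comb mulr_sumr -big_split; apply: eq_bigr => j _ /=.
    by rewrite !ffunE -(mulr_algl a (u j)) rmorphD rmorphM mulrDl mulrA.
  by rewrite WD ?WZ // (fixf_frobenius_morph (in_alg L)).
have SP (u : V) : reflect ((forall j, u j \in FixL r) /\ coord_comb u \in W) (u \in U).
  by rewrite US inE; apply: (iffP andP) => -[/forallP].
exists U; split=> [u j /SP[]//|u v a /SP[ru uW] /SP[rv vW] nz_u Ev|].
  have vE j : v j = a * u j by move/rowP/(_ j): Ev; rewrite !mxE.
  have [j nz_uj] : exists j, u j != 0.
    apply/existsP; apply: contraNT nz_u; rewrite negb_exists => /forallP u0.
    by apply/eqP/ffunP=> j; rewrite ffunE; apply/eqP; have := u0 j; rewrite negbK.
  have ra : a \in FixL r by rewrite -(mulfK nz_uj a) -vE rpred_div ?ru ?rv.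
  rewrite -(fixf_frobenius_morph (in_alg L) i (i \o in_alg L)).
  apply: (scW _ (coord_comb u)); rewrite ?(fixf_frobenius_morph (in_alg L)) //.
    by apply: contraNneq nz_u => /(coord_comb_eq0 ru)->.
  rewrite (_ : _ * _ = coord_comb v) // /coord_comb /power_comb mulr_sumr.
  by apply: eq_bigr => l _; rewrite /= vE rmorphM mulrA.
have <- : \dim {: subvs_of U} = \dim U by rewrite dimvf.
rewrite -card_finvect.
pose f (u : finvect_type (subvs_of U)) := coord_comb (vsval u).
apply: leq_trans (leq_imset_card f predT).
apply/subset_leq_card/subsetP=> y yW.
have [u ru Ey] := coord_comb_onto (rkW y yW); have uU : u \in U by apply/SP; rewrite -Ey.
by apply/imsetP; exists (vsproj U u); rewrite // /f vsprojK.
Qed.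

End Coordinates.

Theorem scattered_submod_min_length (F : finFieldType) (L : fieldExtType F) (r : nat)
    (M : finFieldType) (i : {rmorphism L -> M}) (W : {set M}) :
    (0 < r)%N -> \dim {:L} = (2 * r)%N ->
    (forall d, (d %| r * 3)%N -> #|fixf (frobenius (i \o in_alg L)) d| = (#|F| ^ d)%N) ->
    scattered_submod (frobenius (i \o in_alg L)) 1 r W -> (#|F| ^ (r + 2) <= #|W|)%N ->
  min_length_saturating L 3 2 (r + 2).
Proof.
move=> r_gt0 dimL card_d [W1 W3r scW] cardW.
have card_r := card_d r (dvdn_mulr 3 (dvdnn r)).
have [|c rk_c r'c] := exists_fixf_diff card_r (card_d _ (dvdnn _)); first by lia.
have [|||U [rU scU leWU]] := exists_scattered_vspace _ _ card_r _ rk_c r'c W1 W3r scW => //.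
- by rewrite dimL dvdn_mull.
- by rewrite card_d.
apply: (scattered_min_length r_gt0 dimL rU scU).
by rewrite -(leq_exp2l _ _ (finNzRing_gt1 F)) (leq_trans cardW).
Qed.

(** * Adjoining a vector to a scattered subspace *)

Section Adjoin.

Variables (M : finFieldType) (sigma : {rmorphism M -> M}).
Local Notation Fix := (fixf sigma).
Local Notation submod := (fixf_submod sigma).
Implicit Types (d e r : nat) (W : {set M}) (a x y z l : M).

Lemma fixf_submod_dvdn d e W : (e %| d)%N -> submod d W -> submod e W.
Proof.
by move=> dvd_ed [W0 WD WZ]; split=> // a x /(fixf_dvdn dvd_ed); apply: WZ.
Qed.

Lemma fixf_submodN d W x : submod d W -> x \in W -> - x \in W.
Proof. by case=> _ _ WZ xW; rewrite -mulN1r WZ ?rpredN1. Qed.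

Lemma scattered_submod0 d r : scattered_submod sigma d r [set 0].
Proof.
split; first split=> [|x y|a x _]; rewrite ?inE //.
- by move=> /eqP-> /eqP->; rewrite addr0.
- by move=> /eqP->; rewrite mulr0.
- by move=> x /set1P->; apply: rpred0.
by move=> a x _ /set1P->; rewrite eqxx.
Qed.

Definition adjoin d W z : {set M} := [set w.1 + w.2 * z | w in [predX W & Fix d]].

Lemma adjoinP d W z y :
  reflect (exists x a, [/\ x \in W, a \in Fix d & y = x + a * z]) (y \in adjoin d W z).
Proof.
apply: (iffP imsetP) => [[[x a] /andP[/= xW da] ->] | [x [a [xW da ->]]]].
  by exists x, a.
by exists (x, a); rewrite // inE xW.
Qed.

Lemma adjoin_submod d e W z :
  (e %| d)%N -> submod e W -> submod e (adjoin d W z).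
Proof.
move=> dvd_ed [W0 WD WZ]; split.
- by apply/adjoinP; exists 0, 0; rewrite rpred0 mul0r addr0.
- move=> _ _ /adjoinP[x [a [xW da ->]]] /adjoinP[y [b [yW db ->]]].
  by apply/adjoinP; exists (x + y), (a + b); rewrite WD ?rpredD // mulrDl addrACA.
move=> b _ eb /adjoinP[x [a [xW da ->]]]; have db := fixf_dvdn dvd_ed eb.
by apply/adjoinP; exists (b * x), (b * a); rewrite WZ ?rpredM // mulrDr mulrA.
Qed.

Lemma adjoin_sub d e W z : (d %| e)%N -> z \in Fix e -> {subset W <= Fix e} ->
  {subset adjoin d W z <= Fix e}.
Proof.
move=> dvd_de ez sWe _ /adjoinP[x [a [/sWe ex da ->]]].
by rewrite rpredD ?rpredM // (fixf_dvdn dvd_de).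
Qed.

Lemma card_adjoin d W z :
  submod d W -> z \notin W -> #|adjoin d W z| = (#|W| * #|Fix d|)%N.
Proof.
move=> dW W'z; have [_ WD WZ] := dW.
rewrite card_in_imset ?cardX // => -[x a] [y b] /andP[/= xW da] /andP[/= yW db] /= E.
suffices Eab : a = b by move: E; rewrite Eab => /addIr->.
apply: contraNeq W'z; rewrite -subr_eq0 => nz_ab.
have -> : z = (a - b)^-1 * (y - x).
  apply: (mulfI nz_ab); rewrite mulVKf // (_ : y = x + a * z - b * z); first by ring.
  by rewrite E addrK.
by rewrite WZ ?WD ?(fixf_submodN dW) // rpredV rpredB.
Qed.

(* The equation reads l (x + z) = y + c z: [l] violates the scatteredness of
   [adjoin d W z]. *)
Definition obstruction d r W : {set M} :=
  [set z | [exists l in Fix r, exists c in Fix d, exists x in W, exists y in W,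
     (l \notin Fix 1) && (z * (l - c) == y - l * x)]].

Lemma obstructionP d r W z :
  reflect (exists l c x y, [/\ l \in Fix r, l \notin Fix 1, c \in Fix d
             & [/\ x \in W, y \in W & z * (l - c) = y - l * x]])
          (z \in obstruction d r W).
Proof.
rewrite inE; apply: (iffP exists_inP) => [[l rl /exists_inP[c dc]] | ].
  by case/exists_inP=> x xW /exists_inP[y yW /andP[l1 /eqP E]]; exists l, c, x, y.
case=> l [c [x [y [rl l1 dc [xW yW E]]]]]; exists l => //; apply/exists_inP; exists c => //.
by apply/exists_inP; exists x => //; apply/exists_inP; exists y; rewrite // l1 E eqxx.
Qed.

Lemma obstruction_sub d r W l : submod d W -> l \in Fix r -> l \notin Fix 1 ->
  W \subset obstruction d r W.
Proof.
move=> dW rl l1; have [W0 _ _] := dW; apply/subsetP=> z zW.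
apply/obstructionP; exists l, 0, (- z), 0; split; rewrite ?rpred0 //.
by rewrite W0 (fixf_submodN dW) //; split=> //; ring.
Qed.

Lemma adjoin_scattered d r W z : submod d W -> fixf_scattered sigma r W ->
  z \notin obstruction d r W -> fixf_scattered sigma r (adjoin d W z).
Proof.
move=> [W0 WD WZ] scW obs_z a _ ra /adjoinP[x [b [xW db ->]]] nz_xb.
case/adjoinP=> y [c [yW dc E]]; apply: contraNT obs_z => a'1; apply/obstructionP.
have nz_a : a != 0 by apply: contraNneq a'1 => ->; apply: rpred0.
have [b0 | nz_b] := eqVneq b 0; last first.
  exists a, (b^-1 * c), (b^-1 * x), (b^-1 * y).
  rewrite rpredM ?WZ ?rpredV //; split=> //; split=> //.
  by rewrite (_ : y = a * (x + b * z) - c * z); [field | rewrite E; ring].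
move: E nz_xb; rewrite b0 mul0r addr0 => E nz_x.
have nz_c : c != 0.
  apply: contraNneq a'1 => c0; apply: (scW a x) => //.
  by rewrite E c0 mul0r addr0.
exists a^-1, 0, (c^-1 * y), (c^-1 * x); rewrite rpredV rpred0 !WZ ?rpredV //.
split=> //; split=> //; have -> : x = a^-1 * (y + c * z) by rewrite -E mulKf.
by field; rewrite nz_a nz_c.
Qed.

Lemma adjoin_scattered_submod d r W z : (d %| r * 3)%N -> z \in Fix (r * 3) ->
    scattered_submod sigma d r W -> z \notin obstruction d r W ->
  scattered_submod sigma d r (adjoin d W z).
Proof.
move=> dvd_d z_fix [dW sW scW] obs_z; split; first exact: adjoin_submod.
  exact: adjoin_sub.
exact: adjoin_scattered.
Qed.

End Adjoin.

(** * Exponents congruent to 1 modulo 3 *)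

Section Greedy.

Variables (M : finFieldType) (sigma : {rmorphism M -> M}).
Local Notation Fix := (fixf sigma).
Local Notation submod := (fixf_submod sigma).
Implicit Types (d r : nat) (W : {set M}).

(* Translations by [b] in [Fix 1], (l, c, x, y) -> (l + b, c + b, x, y + b x), act
   freely on the witnesses of an obstruction. *)
Lemma card_obstruction d r W : coprime r d -> submod d W ->
  (#|obstruction sigma d r W| * #|Fix 1|
    <= (#|Fix r| - #|Fix 1|) * #|Fix d| * (#|W| * #|W|))%N.
Proof.
move=> co_rd dW; have [_ WD WZ] := fixf_submod_dvdn (dvd1n d) dW.
have /fin_all_exists[t tP] : forall z, exists t : M * M * (M * M),
    z \in obstruction sigma d r W ->
    [/\ t.1.1 \in Fix r, t.1.1 \notin Fix 1, t.1.2 \in Fix d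
      & [/\ t.2.1 \in W, t.2.2 \in W & z * (t.1.1 - t.1.2) = t.2.2 - t.1.1 * t.2.1]].
  move=> z; have [/obstructionP[l [c [x [y zP]]]]|_] := boolP (z \in _).
    by exists (l, c, (x, y)).
  by exists (0, 0, (0, 0)).
pose g (w : M * M) := ((t w.1).1.1 + w.2, (t w.1).1.2 + w.2,
  ((t w.1).2.1, (t w.1).2.2 + w.2 * (t w.1).2.1)).
pose A := [predX [predX [predD Fix r & Fix 1] & Fix d] & [predX W & W]].
have gA w : w \in [predX obstruction sigma d r W & Fix 1] -> g w \in A.
  case: w => z b /andP[/= /tP[]]; rewrite /g.
  case: (t z) => [[l c] [x y]] /= rl l1 dc [xW yW _] b1; rewrite !inE -!andbA.
  have rb := fixf_dvdn (dvd1n r) b1; have db := fixf_dvdn (dvd1n d) b1.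
  by rewrite xW WD ?WZ // rpredDr // l1 !rpredD.
have g_obs z b : z \in obstruction sigma d r W -> let u := g (z, b) in
    u.1.1 - u.1.2 != 0 /\ z * (u.1.1 - u.1.2) = u.2.2 - u.1.1 * u.2.1.
  case/tP=> rl l1 dc [_ _ Ez]; rewrite /= opprD addrACA subrr addr0 Ez; split; last by ring.
  apply: contra l1; rewrite subr_eq0 => /eqP lc.
  by apply: fixf_coprime co_rd rl _; rewrite lc.
have g_inj : {in [predX obstruction sigma d r W & Fix 1] &, injective g}.
  move=> [z b] [z' b'] /andP[/= obs_z _] /andP[/= obs_z' _] eq_g.
  have [nz_g gz] := g_obs z b obs_z; have [_ gz'] := g_obs z' b' obs_z'.
  have Ezz' : z = z' by apply: (mulIf nz_g); rewrite gz eq_g gz'.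
  by case: eq_g; rewrite -Ezz' => /addrI->.
have cardA : #|A| = ((#|Fix r| - #|Fix 1|) * #|Fix d| * (#|W| * #|W|))%N.
  rewrite !cardX; congr (_ * _ * _)%N; rewrite -(cardID (Fix 1) (Fix r)).
  rewrite (_ : #|[predI Fix r & Fix 1]| = #|Fix 1|) ?addKn //.
  by apply: eq_card => x; rewrite !inE andb_idl //; apply: fixf_dvdn.
rewrite -cardA -cardX -(card_in_imset g_inj).
by apply/subset_leq_card/subsetP=> _ /imsetP[w /gA Aw ->].
Qed.

Variable q : nat.
Hypothesis q_gt1 : (1 < q)%N.

Lemma exists_scattered_submod3 r b :
    (1 < r)%N -> ~~ (3 %| r)%N -> (forall d, (d %| r * 3)%N -> #|Fix d| = (q ^ d)%N) ->
    (3 * b < r + 3)%N ->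
  exists2 W, scattered_submod sigma 3 r W & #|W| = (q ^ (3 * b))%N.
Proof.
move=> r_gt1 r3 card_d; have card_r3 := card_d _ (dvdnn _).
have card_r := card_d r (dvdn_mulr 3 (dvdnn r)).
have card_3 := card_d 3 (dvdn_mull r (dvdnn 3)); have card_1 := card_d 1 (dvd1n _).
elim: b => [|b IHb] lt_b.
  by exists [set 0]; [apply: scattered_submod0 | rewrite cards1].
have [|W scW cardW] := IHb; first by lia.
have [W3 sW _] := scW.
have /subsetPn[l rl l1] : ~~ (Fix r \subset Fix 1).
  by apply/negP=> /subset_leq_card; rewrite card_r card_1 leq_exp2l // leqNgt r_gt1.
have /subsetPn[z z_fix obs_z] : ~~ (Fix (r * 3) \subset obstruction sigma 3 r W).
  apply/negP=> /subset_leq_card leFix.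
  have co_r3 : coprime r 3 by rewrite coprime_sym prime_coprime.
  have := leq_trans (leq_mul leFix (leqnn #|Fix 1|)) (card_obstruction co_r3 W3).
  rewrite cardW card_r3 card_r card_3 card_1.
  apply/negP; rewrite -ltnNge -mulnA -!expnD.
  apply: leq_ltn_trans (_ : (q ^ r - q ^ 1) * q ^ (2 * r + 1) < _)%N.
    by rewrite leq_mul2l leq_exp2l //; lia.
  rewrite mulnBl -!expnD (_ : r + (2 * r + 1) = r * 3 + 1)%N; last by lia.
  by rewrite ltn_subrL !expn_gt0 ltnW.
exists (adjoin sigma 3 W z); first by apply: adjoin_scattered_submod; rewrite ?dvdn_mull.
rewrite card_adjoin //; last first.
  by apply: contra obs_z; apply/subsetP/(obstruction_sub W3 rl l1).
by rewrite cardW card_3 -expnD; congr (_ ^ _)%N; lia.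
Qed.

End Greedy.

Theorem mod3_min_length (F : finFieldType) (L : fieldExtType F) r :
    (1 < r)%N -> \dim {:L} = (2 * r)%N -> (r %% 3 = 1)%N ->
  min_length_saturating L 3 2 (r + 2).
Proof.
move=> r_gt1 dimL r_mod3; have q_gt1 := finNzRing_gt1 F.
have [|M [i card_d]] := @exists_card_fixf_ext F L (r * 3); first by lia.
have [||W [W3 sW scW] cardW] :=
  exists_scattered_submod3 (b := (r %/ 3).+1) q_gt1 r_gt1 _ card_d _; try lia.
apply: (scattered_submod_min_length (W := W) _ dimL card_d); first by lia.
  by split=> //; apply: fixf_submod_dvdn W3.
by rewrite cardW leq_exp2l //; lia.
Qed.

(** * Even exponents *)

(* [x] and [f x] span no subspace invariant under [f]. *)
Definition irreducible_semilinear (M : fieldType) (sigma : {rmorphism M -> M}) t m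
    (f : M -> M) : Prop :=
  [/\ {in fixf sigma (t * 3), forall x, f x \in fixf sigma (t * 3)},
      {in fixf sigma (t * 3) &, forall x y, f (x + y) = f x + f y},
      {in fixf sigma t & fixf sigma (t * 3), forall a x, f (a * x) = iter m sigma a * f x}
    & forall x e g, x \in fixf sigma (t * 3) -> e \in fixf sigma t -> g \in fixf sigma t ->
        f (f x) = e * x + g * f x -> x = 0].

Section SemilinearGraph.

Variables (M : finFieldType) (sigma : {rmorphism M -> M}) (t m : nat).
Local Notation Fix := (fixf sigma).
Implicit Types (a b e g l x y : M).

Variables (f : M -> M) (w : M).
Hypotheses (f_irr : irreducible_semilinear sigma t m f) (co_tm : coprime t m).
Hypotheses (w2t : w \in Fix (t * 2)) (w't : w \notin Fix t).
Hypothesis card_2t : #|Fix (t * 2)| = (#|Fix t| ^ 2)%N.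

Lemma quadratic_decomp y : y \in Fix (t * 2) ->
  exists a b, [/\ a \in Fix t, b \in Fix t & y = a + b * w].
Proof.
case/(power_comb_onto (n := 2) _ w2t w't card_2t) => // a ta ->.
exists (a ord0), (a (lift ord0 ord0)).
by rewrite /power_comb !big_ord_recl big_ord0 mulr1 addr0.
Qed.

Let w'3t : w \notin Fix (t * 3).
Proof. by apply: contra w't => /(fixf_gcdn w2t); rewrite -muln_gcdr muln1. Qed.

Lemma graph_inj x y x' y' : x \in Fix (t * 3) -> y \in Fix (t * 3) ->
  x' \in Fix (t * 3) -> y' \in Fix (t * 3) -> x + w * y = x' + w * y' -> x = x' /\ y = y'.
Proof.
move=> tx ty tx' ty' E.
suffices Ey : y = y' by move: E; rewrite Ey => /addIr.
apply: contraNeq w'3t; rewrite -subr_eq0 => nz_y.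
rewrite (_ : w = (x' - x) / (y - y')) ?rpred_div ?rpredB //.
apply: (mulIf nz_y); rewrite divfK // (_ : x' = x + w * y - w * y'); first by ring.
by rewrite E addrK.
Qed.

Definition graph := [set x + w * f x | x in Fix (t * 3)].

Let f0 : f 0 = 0.
Proof.
by have [_ _ fZ _] := f_irr; rewrite -[in LHS](mul0r 0) fZ ?rpred0 // rmorph0 mul0r.
Qed.

Lemma graph_scattered : fixf_scattered sigma (t * 2) graph.
Proof.
move=> l _ l2t /imsetP[x tx ->] nz_x /imsetP[y ty E].
have [ft fD fZ f_indep] := f_irr; have sub_t z : z \in Fix t -> z \in Fix (t * 3).
  exact/fixf_dvdn/dvdn_mulr.
have [B [A [tB tA Ew]]] : exists B A, [/\ B \in Fix t, A \in Fix t & w ^+ 2 = B + A * w].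
  by apply: quadratic_decomp; rewrite rpredX.
have [a [b [ta tb El]]] := quadratic_decomp l2t.
have nz_fx : f x != 0.
  apply: contraNneq nz_x => fx0; rewrite fx0 mulr0 addr0.
  apply/eqP/(f_indep x 0 0); rewrite ?rpred0 //.
  by rewrite fx0 f0 mulr0 mul0r addr0.
have tbB : b * B \in Fix t by rewrite rpredM.
have [||||| Ey Efy] := @graph_inj (a * x + b * B * f x) (b * x + (a + b * A) * f x) y (f y).
- by rewrite rpredD ?rpredM ?ft // sub_t.
- by rewrite rpredD ?rpredM ?ft // sub_t // rpredD ?rpredM.
- by [].
- exact: ft.
- by rewrite -E El; ring: Ew.
have {Ey}Efy : b * x + (a + b * A) * f x
    = iter m sigma a * f x + iter m sigma (b * B) * f (f x).
  by rewrite Efy -Ey fD ?fZ ?rpredM ?ft // sub_t.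
have [b0 | nz_b] := eqVneq b 0.
  rewrite El b0 mul0r addr0; apply: fixf_coprime co_tm ta _; rewrite fixfE eq_sym.
  apply/eqP/(mulIf nz_fx); move: Efy; rewrite b0 !mul0r rmorph0 mul0r add0r !addr0.
  by [].
have nz_B : B != 0.
  apply: contraNneq w't => B0; have nz_w : w != 0.
    by apply: contraNneq w't => ->; apply: rpred0.
  by rewrite (_ : w = A) //; apply: (mulIf nz_w); rewrite -expr2 Ew B0 add0r.
have nz_bB : iter m sigma (b * B) != 0 by rewrite fmorph_eq0 mulf_neq0.
have := fixf_iter m tbB; move: (iter m sigma (b * B)) nz_bB Efy => c nz_c Efy tc.
have x0 : x = 0.
  apply: (f_indep x (b / c) ((a + b * A - iter m sigma a) / c)) => //.
  - by rewrite rpred_div.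
  - by rewrite rpred_div ?rpredB ?rpredD ?rpredM ?fixf_iter.
  by apply: (mulfI nz_c); rewrite -[LHS](addKr (iter m sigma a * f x)) -Efy; field.
by case/eqP: nz_fx; rewrite x0 f0.
Qed.

Lemma graph_scattered_submod : scattered_submod sigma 1 (t * 2) graph.
Proof.
have [ft fD fZ _] := f_irr; split; last exact: graph_scattered.
  apply: imset_fixf_submod => [|x y tx ty|a x a1 tx]; first exact: dvd1n.
    by rewrite fD // mulrDr addrACA.
  rewrite fZ ?(fixf_dvdn (dvd1n t)) // mulrDr mulrCA; congr (_ + _ * (_ * _)).
  exact/fixfP/(fixf_dvdn (dvd1n m)).
move=> _ /imsetP[x tx ->].
have sub6 z : z \in Fix (t * 3) -> z \in Fix (t * 2 * 3).
  by apply: fixf_dvdn; rewrite mulnAC dvdn_mulr.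
have w6 : w \in Fix (t * 2 * 3) by apply: fixf_dvdn w2t; rewrite dvdn_mulr.
by rewrite rpredD ?rpredM //; apply: sub6 => //; apply: ft.
Qed.

Lemma card_graph : #|graph| = #|Fix (t * 3)|.
Proof.
have [ft _ _ _] := f_irr; rewrite card_in_imset // => x y tx ty.
by case/(graph_inj tx (ft x tx) ty (ft y ty)).
Qed.

End SemilinearGraph.

Theorem irreducible_min_length (F : finFieldType) (L : fieldExtType F)
    (M : finFieldType) (i : {rmorphism L -> M}) t m f :
    let sigma := frobenius (i \o in_alg L) in
    (1 < t)%N -> \dim {:L} = (2 * (t * 2))%N ->
    (forall d, (d %| t * 2 * 3)%N -> #|fixf sigma d| = (#|F| ^ d)%N) ->
    coprime t m -> irreducible_semilinear sigma t m f ->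
  min_length_saturating L 3 2 (t * 2 + 2).
Proof.
move=> sigma t_gt1 dimL card_d co_tm f_irr.
have card_t : #|fixf sigma t| = (#|F| ^ t)%N by rewrite card_d // -mulnA dvdn_mulr.
have card_2t : #|fixf sigma (t * 2)| = (#|F| ^ (t * 2))%N by rewrite card_d // dvdn_mulr.
have card_3t : #|fixf sigma (t * 3)| = (#|F| ^ (t * 3))%N.
  by rewrite card_d // mulnAC dvdn_mulr.
have [|w w2t w't] := exists_fixf_diff card_t card_2t; first by lia.
apply: (scattered_submod_min_length (i := i) (W := graph sigma t f w)) => //; first by lia.
  by apply: (graph_scattered_submod f_irr co_tm); rewrite ?card_2t ?card_t ?expnM.
by rewrite (card_graph f_irr) // card_3t leq_exp2l ?finNzRing_gt1 //; lia.
Qed.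

Section Norm.

Variables (M : fieldType) (sigma : {rmorphism M -> M}).
Local Notation Fix := (fixf sigma).

Definition fixf_norm d k a := \prod_(j < k) iter (d * j) sigma a.

Lemma fixf_normS d k a : fixf_norm d k.+1 a = a * iter d sigma (fixf_norm d k a).
Proof.
rewrite /fixf_norm big_ord_recl muln0 rmorph_prod; congr (_ * _).
by apply: eq_bigr => j _; rewrite /= -iterD -mulnS.
Qed.

Lemma fixf_norm_fix d k a : a \in Fix (d * k) -> fixf_norm d k a \in Fix d.
Proof.
case: k => [|k] /fixfP Ea; first by rewrite /fixf_norm big_ord0 rpred1.
apply/fixfP; rewrite [RHS]fixf_normS mulrC rmorph_prod big_ord_recr /=.
by rewrite -iterD -mulnS Ea rmorph_prod; congr (_ * _).
Qed.

Lemma iter_scaled_iter d k a x :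
  iter k (fun y => a * iter d sigma y) x = fixf_norm d k a * iter (d * k) sigma x.
Proof.
elim: k => [|k IHk]; first by rewrite /fixf_norm big_ord0 muln0 mul1r.
by rewrite iterS IHk rmorphM fixf_normS mulnS iterD mulrA.
Qed.

End Norm.

Lemma exists_fixf_norm (F M : finFieldType) (f : {rmorphism F -> M}) d k :
    (1 < d)%N -> (0 < k)%N -> #|fixf (frobenius f) (d * k)| = (#|F| ^ (d * k))%N ->
  exists a, [/\ a \in fixf (frobenius f) (d * k), a != 0
    & fixf_norm (frobenius f) d k a \notin fixf (frobenius f) 1].
Proof.
move=> d_gt1 k_gt0 card_dk; set q := #|F| in card_dk *; set Fix := fixf _.
have q_gt1 : (1 < q)%N := finNzRing_gt1 F; have q_gt0 := ltnW q_gt1.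
pose n := (\sum_(j < k) (q ^ d) ^ j)%N.
have normE a : fixf_norm (frobenius f) d k a = a ^+ n.
  rewrite -prodrXr; apply: eq_bigr => j _.
  by rewrite iter_frobenius expnM.
have n_gt0 : (0 < n)%N.
  by rewrite /n; case: (k) k_gt0 => // k' _; rewrite big_ord_recl addn_gt0.
have [a /andP[nz_a dk_a] N_a] : exists2 a, (a != 0) && (a \in Fix (d * k)%N)
    & a ^+ n \notin Fix 1%N; last first.
  by exists a; rewrite normE.
apply/exists_inP; apply: contraT; rewrite negb_exists_in => /forall_inP all1.
have : (#|[predD1 Fix (d * k) & 0%R]| <= n * q.-1)%N.
  rewrite cardE; apply: max_unity_roots; rewrite ?enum_uniq //.
    by rewrite muln_gt0 n_gt0 -ltnS prednK.
  apply/allP=> a; rewrite mem_enum => /[dup]/andP[nz_a _] /all1.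
  rewrite negbK unity_rootE exprM fixfE /= /frobenius -/q => /eqP Na.
  by rewrite -(inj_eq (mulIf (expf_neq0 n nz_a))) -exprSr (prednK q_gt0) mul1r Na.
have := cardD1 0 (Fix (d * k)%N); rewrite rpred0 card_dk add1n => /(congr1 predn) /= <-.
rewrite expnM predn_exp mulnC leq_pmul2l // leqNgt -ltnS !prednK ?expn_gt0 ?q_gt0 //.
by rewrite -{1}[q]expn1 ltn_exp2l ?d_gt1.
Qed.

Lemma iter_scalar_irr (M : fieldType) (sigma : {rmorphism M -> M}) t (f : M -> M) theta :
    coprime t 3 -> theta \in fixf sigma 3 -> theta \notin fixf sigma 1 ->
    {morph f : x y / x + y} -> (forall a x, f (a * x) = iter 3 sigma a * f x) ->
    {in fixf sigma (t * 3), forall x, f x \in fixf sigma (t * 3)} ->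
    {in fixf sigma (t * 3), forall x, iter t f x = theta * x} ->
  irreducible_semilinear sigma t 3 f.
Proof.
move=> co_t3 theta3 theta'1 fD fZ ft f_theta.
split=> [//|x y _ _|a x _ _|x e g tx te tg Eff]; rewrite ?fD ?fZ //.
have theta't : theta \notin fixf sigma t.
  by apply: contra theta'1 => theta_t; apply: fixf_coprime co_t3 theta_t theta3.
have theta_t3 : theta \in fixf sigma (t * 3) by apply: fixf_dvdn theta3; apply: dvdn_mull.
have span k : exists p s, [/\ p \in fixf sigma t, s \in fixf sigma t
    & iter k f x = p * x + s * f x].
  elim: k => [|k [p [s [tp ts IHk]]]].
    by exists 1, 0; rewrite rpred1 rpred0 mul1r mul0r addr0.
  exists (iter 3 sigma s * e), (iter 3 sigma p + iter 3 sigma s * g).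
  rewrite [LHS]iterS IHk fD !fZ Eff rpredM ?rpredD ?rpredM ?fixf_iter //.
  by split=> //; ring.
have [p [s [tp ts]]] := span t; rewrite f_theta // => Ex.
have {}Ex : s * f x = (theta - p) * x by rewrite mulrBl Ex; ring.
have Efx : iter 3 sigma s * f (f x) = (theta - iter 3 sigma p) * f x.
  by rewrite -fZ Ex fZ -{2}(fixfP theta3) -rmorphB.
have := fixf_iter 3 tp; have := fixf_iter 3 ts.
move: (iter 3 sigma s) (iter 3 sigma p) Efx => s' p' Efx ts' tp'.
apply: contraTeq isT => nz_x.
have [||||_ _ /eqP] := fixf_lin_indep3 (a0 := p * p' - s' * (s * e - g * p))
  (a1 := - (p + p' + s' * g)) (a2 := 1) theta_t3 theta't.
- by rewrite rpredB ?rpredM ?rpredB ?rpredM.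
- by rewrite rpredN !rpredD ?rpredM.
- exact: rpred1.
- apply: (mulIf nz_x); rewrite mul0r.
  transitivity (s * ((theta - p') * f x - s' * (e * x + g * f x))); first by ring: Ex.
  by rewrite -Eff Efx subrr mulr0.
by rewrite oner_eq0.
Qed.

Theorem even_coprime3_min_length (F : finFieldType) (L : fieldExtType F) t :
    (1 < t)%N -> coprime t 3 -> \dim {:L} = (2 * (t * 2))%N ->
  min_length_saturating L 3 2 (t * 2 + 2).
Proof.
move=> t_gt1 co_t3 dimL.
have [|M [i card_d]] := @exists_card_fixf_ext F L (t * 2 * 3); first by lia.
have [|||a [a_fix nz_a norm_a]] := @exists_fixf_norm F M (i \o in_alg L) 3 t => //.
  by lia.
  by rewrite card_d // mulnAC [(t * 3)%N]mulnC dvdn_mulr.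
pose f x := a * iter 3 (frobenius (i \o in_alg L)) x.
apply: (irreducible_min_length (i := i) (f := f) (m := 3)) => //.
apply: (iter_scalar_irr co_t3 (fixf_norm_fix a_fix) norm_a).
- by move=> x y; rewrite /f rmorphD mulrDr.
- by move=> b x; rewrite /f rmorphM mulrCA.
- by move=> x tx; rewrite rpredM ?fixf_iter // mulnC.
by move=> x tx; rewrite iter_scaled_iter mulnC (fixfP tx).
Qed.

Lemma vandermonde_eq0 (R : fieldType) n (theta y : 'I_n -> R) : injective theta ->
  (forall j : 'I_n, \sum_i theta i ^+ j * y i = 0) -> forall i, y i = 0.
Proof.
move=> theta_inj sum0 i; pose V := Vandermonde n (\row_i theta i).
have unitV : V \in unitmx.
  rewrite unitmxE det_Vandermonde unitfE prodf_seq_neq0; apply/allP=> j _ /=.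
  rewrite prodf_seq_neq0; apply/allP=> l _; apply/implyP=> lt_jl.
  by rewrite !mxE subr_eq0 (inj_eq theta_inj) -(inj_eq val_inj) gtn_eqF.
have /(congr1 (mulmx (invmx V))) : V *m (\col_i y i) = 0.
  by apply/colP=> j; rewrite !mxE -[RHS](sum0 j); apply: eq_bigr => l _; rewrite !mxE.
by rewrite mulKmx // mulmx0 => /colP/(_ i); rewrite !mxE.
Qed.

Lemma exists_orthogonal (R : fieldType) n (x y : 'I_n -> R) : (2 < n)%N ->
  exists h : 'I_n -> R,
    [/\ exists i, h i != 0, \sum_i h i * x i = 0 & \sum_i h i * y i = 0].
Proof.
move=> n_gt2; pose A := \matrix_(i < n, j < 2) if j == 0 then x i else y i.
have /rowV0Pn[h /sub_kermxP hA nz_h] : kermx A != 0.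
  by rewrite kermx_eq0 /row_free neq_ltn (leq_ltn_trans (rank_leq_col A)).
exists (h 0); split.
- apply/existsP; apply: contraNT nz_h => /existsPn h0.
  by apply/eqP/rowP=> i; rewrite mxE; apply/eqP; have := h0 i; rewrite negbK.
- have /rowP/(_ 0) := hA; rewrite !mxE => hA0; rewrite -[RHS]hA0.
  by apply: eq_bigr => i _; rewrite mxE.
have /rowP/(_ 1) := hA; rewrite !mxE => hA1; rewrite -[RHS]hA1.
by apply: eq_bigr => i _; rewrite mxE.
Qed.

Section CyclicMap.

Variables (M : fieldType) (sigma : {rmorphism M -> M}) (d : M).
Local Notation Fix := (fixf sigma).
Local Notation V := {ffun 'I_3 -> M}.
Implicit Types (x y : V) (i : 'I_3) (p s e g : M).

Definition cyclic_map x : V :=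
  [ffun i : 'I_3 => (if i == 0 then d else 1) * sigma (x (i - 1))].

Definition lin_comb p s x y : V := [ffun i => p * x i + s * y i].

Lemma cyclic_map_comb p s x y : cyclic_map (lin_comb p s x y)
  = lin_comb (sigma p) (sigma s) (cyclic_map x) (cyclic_map y).
Proof. by apply/ffunP=> i; rewrite !ffunE rmorphD !rmorphM; ring. Qed.

Lemma iter_cyclic_map_span x e g n :
    cyclic_map (cyclic_map x) = lin_comb e g x (cyclic_map x) ->
  exists p s, iter n cyclic_map x = lin_comb p s x (cyclic_map x).
Proof.
move=> Exx; elim: n => [|n [p [s IHn]]].
  by exists 1, 0; apply/ffunP=> i; rewrite ffunE /= mul1r mul0r addr0.
exists (sigma s * e), (sigma p + sigma s * g); rewrite iterS IHn cyclic_map_comb Exx.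
by apply/ffunP=> i; rewrite !ffunE; ring.
Qed.

Lemma iter3_cyclic_map x i :
  iter 3 cyclic_map x i = iter i sigma d * iter 3 sigma (x i).
Proof.
have I3 (j : 'I_3) : j - 1 - 1 - 1 = j by case: j => -[|[|[|//]]] ?; apply: val_inj.
rewrite /= !ffunE I3 !rmorphM !mulrA; congr (_ * _).
by case: i => -[|[|[|//]]] ? /=; rewrite ?rmorph1 ?mulr1 ?mul1r.
Qed.

Lemma iter_muln3_cyclic_map k x i :
  iter (3 * k) cyclic_map x i
    = iter i sigma (fixf_norm sigma 3 k d) * iter (3 * k) sigma (x i).
Proof.
elim: k => [|k IHk]; first by rewrite muln0 /fixf_norm big_ord0 rmorph1 mul1r.
rewrite mulnS !(iterD 3 (3 * k)) iter3_cyclic_map IHk fixf_normS.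
rewrite [iter 3 sigma (_ * _)]rmorphM [iter i sigma (_ * _)]rmorphM -mulrA.
congr (_ * (_ * _)).
by rewrite -[LHS](iterD 3 i) addnC [LHS]iterD.
Qed.

Lemma cyclic_map_fixf t x : d \in Fix t -> (forall i, x i \in Fix t) ->
  forall i, cyclic_map x i \in Fix t.
Proof.
move=> td tx i; rewrite ffunE rpredM ?(fixf_iter 1) //.
by case: ifP => _; rewrite ?rpred1.
Qed.

Lemma cyclic_map_eq0 x i : d != 0 -> cyclic_map x i = 0 -> x (i - 1) = 0.
Proof.
move=> nz_d /eqP; rewrite ffunE mulf_eq0 fmorph_eq0 => /orP[|/eqP//].
by case: ifP => _; rewrite ?(negPf nz_d) ?oner_eq0.
Qed.

Variable k : nat.
Local Notation t := (3 * k)%N.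
Local Notation theta := (fixf_norm sigma 3 k d).
Hypotheses (td : d \in Fix t) (nz_d : d != 0) (theta'1 : theta \notin Fix 1).

Lemma iter_cyclic_map_scale j x i : (forall i, x i \in Fix t) ->
  iter (t * j) cyclic_map x i = iter i sigma theta ^+ j * x i.
Proof.
move=> tx; have t_theta l : iter l sigma theta \in Fix t.
  by rewrite fixf_iter // (fixf_dvdn (dvdn_mulr k (dvdnn 3))) // fixf_norm_fix.
elim: j i => [|j IHj] i; first by rewrite muln0 expr0 mul1r.
have t_prod : iter i sigma theta ^+ j * x i \in Fix t by rewrite rpredM ?rpredX.
by rewrite mulnS iterD iter_muln3_cyclic_map IHj (fixfP t_prod) exprS mulrA.
Qed.

(* The conjugates of [theta] are eigenvalues of [iter t cyclic_map] with one-dimensional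
   eigenspaces: a functional vanishing on an orbit vanishes coordinatewise on it. *)
Lemma orbit_orthogonal (h : 'I_3 -> M) x : (forall i, x i \in Fix t) ->
    (forall n, \sum_i h i * iter n cyclic_map x i = 0) ->
  forall n i, h i * iter n cyclic_map x i = 0.
Proof.
move=> tx hx n; have t_iter : forall i, iter n cyclic_map x i \in Fix t.
  by elim: n => //= n; apply: cyclic_map_fixf.
apply: (@vandermonde_eq0 _ _ (fun i : 'I_3 => iter i sigma theta)).
  have th3 : theta \in Fix (1 * 3) by rewrite fixf_norm_fix.
  move=> i j E; apply: val_inj.
  apply: (iter_fixf_inj _ th3 theta'1); rewrite ?inE ?ltn_ord //.
  by rewrite !mul1n.
move=> j; rewrite -[RHS](hx (t * j + n)%N); apply: eq_bigr => i _.
by rewrite iterD iter_cyclic_map_scale // mulrCA.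
Qed.

Lemma cyclic_map_irr x e g : (forall i, x i \in Fix t) ->
  cyclic_map (cyclic_map x) = lin_comb e g x (cyclic_map x) -> x = 0.
Proof.
move=> tx Exx.
have [h [[i0 nz_hi0] hx hfx]] := exists_orthogonal x (cyclic_map x) (ltnSn 2).
have h_iter n : \sum_i h i * iter n cyclic_map x i = 0.
  have [p [s ->]] := iter_cyclic_map_span n Exx.
  transitivity (p * (\sum_i h i * x i) + s * (\sum_i h i * cyclic_map x i)).
    by rewrite !mulr_sumr -big_split; apply: eq_bigr => i _; rewrite [in LHS]ffunE /=; ring.
  by rewrite hx hfx !mulr0 addr0.
have x_i0 n : iter n cyclic_map x i0 = 0.
  have /eqP := orbit_orthogonal tx h_iter n i0.
  by rewrite mulf_eq0 (negPf nz_hi0) => /eqP.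
have x0 := x_i0 0%N; have x1 := cyclic_map_eq0 nz_d (x_i0 1%N).
have x2 := cyclic_map_eq0 nz_d (cyclic_map_eq0 nz_d (x_i0 2)).
apply/ffunP=> i; rewrite ffunE; suff /or3P[] : [|| i == i0, i == i0 - 1 | i == i0 - 1 - 1].
- by move/eqP->.
- by move/eqP->.
- by move/eqP->.
by case: (i) (i0) => -[|[|[|//]]] ? [[|[|[|//]]] ?].
Qed.

End CyclicMap.

Lemma power_comb_fixf (M : fieldType) (sigma : {rmorphism M -> M}) d n x (a : 'I_n -> M) :
  x \in fixf sigma d -> (forall j, a j \in fixf sigma d) -> power_comb x a \in fixf sigma d.
Proof. by move=> dx da; rewrite rpred_sum // => j _; rewrite rpredM ?rpredX. Qed.

Lemma exists_coordinates (M : finFieldType) (sigma : {rmorphism M -> M}) d n x :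
    prime n -> x \in fixf sigma (d * n) -> x \notin fixf sigma d ->
    #|fixf sigma (d * n)| = (#|fixf sigma d| ^ n)%N ->
  exists co : M -> {ffun 'I_n -> M},
    {in fixf sigma (d * n), forall y,
       (forall j, co y j \in fixf sigma d) /\ y = power_comb x (co y)}
    /\ forall a : {ffun 'I_n -> M},
         (forall j, a j \in fixf sigma d) -> co (power_comb x a) = a.
Proof.
move=> n_pr dn_x d'x card_dn.
have /fin_all_exists[co coP] : forall y, exists a : {ffun 'I_n -> M},
    y \in fixf sigma (d * n) -> (forall j, a j \in fixf sigma d) /\ y = power_comb x a.
  move=> y; have [/(power_comb_onto n_pr dn_x d'x card_dn)[a da Ey] | _] := boolP (y \in _).
    exists (finfun a) => _; split=> [j|]; first by rewrite ffunE.
    by rewrite Ey; apply: eq_bigr => j _; rewrite ffunE.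
  by exists 0.
exists co; split=> // a da; have [|dco Eco] := coP (power_comb x a).
  by apply: power_comb_fixf => // j; apply: fixf_dvdn (da j); apply: dvdn_mulr.
apply/ffunP=> j; apply/subr0_eq/(power_comb_eq0 n_pr dn_x d'x (a := fun l => _ l - a l)).
  by move=> l; rewrite rpredB.
by rewrite -power_combB -Eco subrr.
Qed.

Lemma power_comb_lin (M : fieldType) c p s (a b : {ffun 'I_3 -> M}) :
  power_comb c (lin_comb p s a b) = p * power_comb c a + s * power_comb c b.
Proof. by rewrite !mulr_sumr -big_split; apply: eq_bigr => j _; rewrite ffunE /=; ring. Qed.

Lemma exists_irreducible_cyclic (M : finFieldType) (sigma : {rmorphism M -> M}) k c d
    (t := (3 * k)%N) :
    c \in fixf sigma (t * 3) -> c \notin fixf sigma t ->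
    #|fixf sigma (t * 3)| = (#|fixf sigma t| ^ 3)%N ->
    d \in fixf sigma t -> d != 0 -> fixf_norm sigma 3 k d \notin fixf sigma 1 ->
  exists f, irreducible_semilinear sigma t 1 f.
Proof.
move=> tc c't card_t3 td nz_d norm_d.
have [co [coP coK]] := exists_coordinates (n := 3) isT tc c't card_t3.
pose f x := power_comb c (cyclic_map sigma d (co x)).
have fE (a : {ffun 'I_3 -> M}) : (forall j, a j \in fixf sigma t) ->
    f (power_comb c a) = power_comb c (cyclic_map sigma d a).
  by move=> /coK; rewrite /f => ->.
have t_comb p s (a b : {ffun 'I_3 -> M}) : p \in fixf sigma t -> s \in fixf sigma t ->
    (forall j, a j \in fixf sigma t) -> (forall j, b j \in fixf sigma t) ->
    forall j, lin_comb p s a b j \in fixf sigma t.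
  by move=> tp ts ta tb j; rewrite ffunE rpredD ?rpredM.
have f_lin p s x y : p \in fixf sigma t -> s \in fixf sigma t ->
    x \in fixf sigma (t * 3) -> y \in fixf sigma (t * 3) ->
    f (p * x + s * y) = sigma p * f x + sigma s * f y.
  move=> tp ts /coP[ta ->] /coP[tb ->]; rewrite -power_comb_lin !fE //; last first.
    by move=> j; apply: t_comb.
  by rewrite cyclic_map_comb power_comb_lin.
exists f; split=> [x /coP[ta _]|x y tx ty|a x ta tx|x e g /coP[ta ->] te tg].
- apply: power_comb_fixf => // j; apply: fixf_dvdn (dvdn_mulr 3 (dvdnn t)) _.
  exact: cyclic_map_fixf.
- by have := f_lin 1 1 x y; rewrite !mul1r !rmorph1 !mul1r; apply; rewrite ?rpred1.
- by have := f_lin a 0 x x; rewrite !mul0r rmorph0 !mul0r !addr0; apply; rewrite ?rpred0.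
have t_cyc := cyclic_map_fixf td ta; have t_cyc2 := cyclic_map_fixf td t_cyc.
have t_lin := t_comb e g _ _ te tg ta t_cyc.
rewrite !fE // -power_comb_lin => /(congr1 co); rewrite !coK //.
move/(cyclic_map_irr td nz_d norm_d ta)->.
by rewrite /power_comb big1 // => j _; rewrite ffunE mul0r.
Qed.

Theorem even_dvdn3_min_length (F : finFieldType) (L : fieldExtType F) t :
    (0 < t)%N -> (3 %| t)%N -> \dim {:L} = (2 * (t * 2))%N ->
  min_length_saturating L 3 2 (t * 2 + 2).
Proof.
move=> t_gt0 /dvdnP[k Et]; rewrite mulnC in Et; rewrite {t}Et in t_gt0 * => dimL.
set t := (3 * k)%N in t_gt0 dimL *.
have [|M [i card_d]] := @exists_card_fixf_ext F L (t * 2 * 3); first by lia.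
set sigma := frobenius (i \o in_alg L) in card_d.
have card_t : #|fixf sigma t| = (#|F| ^ t)%N by rewrite card_d // -mulnA dvdn_mulr.
have card_3t : #|fixf sigma (t * 3)| = (#|F| ^ (t * 3))%N.
  by rewrite card_d // mulnAC dvdn_mulr.
have [|c tc c't] := exists_fixf_diff card_t card_3t; first by lia.
have [|||d [td nz_d norm_d]] := @exists_fixf_norm F M (i \o in_alg L) 3 k => //.
  by lia.
have [|f f_irr] := exists_irreducible_cyclic tc c't _ td nz_d norm_d.
  by rewrite card_t card_3t expnM.
apply: (irreducible_min_length (i := i) (f := f) (m := 1)) => //; first by lia.
exact: coprimen1.
Qed.

(** * Exponents prime to the order of GL_2(F) *)

Lemma frobenius_img (F : finFieldType) (R : comNzRingType) (f : {rmorphism F -> R}) a :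
  frobenius f (f a) = f a.
Proof. by rewrite /frobenius -rmorphXn /= expf_card. Qed.

Section Moebius.

Variables (F : finFieldType) (M : fieldType) (f : {rmorphism F -> M}) (r : nat).
Local Notation q := #|F|.
Local Notation sigma := (frobenius f).
Local Notation Fix := (fixf sigma).
Hypothesis co_r : coprime r #|'GL_2[F]%g|.

(* The Frobenius orbit of [x] is the orbit of [x] under a projectivity over [F]. *)
Lemma moebius_fixf1 (g : 'M[F]_2) x : g \in unitmx -> x \in Fix r ->
    sigma x * (f (g 1 0) * x + f (g 1 1)) = f (g 0 0) * x + f (g 0 1) ->
  x \in Fix 1.
Proof.
move=> unit_g rx Ex; pose G := map_mx f g; pose t := f (g 1 0) * x + f (g 1 1).
pose v y : 'cV[M]_2 := \col_j (if j == 0 then y else 1).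
have map_v k y : map_mx (iter k sigma) (v y) = v (iter k sigma y).
  by apply/colP=> j; rewrite !mxE; case: ifP => //; rewrite rmorph1.
have map_G k : map_mx (iter k sigma) G = G.
  by apply/matrixP=> j l; rewrite !mxE; elim: k => //= k ->; apply: frobenius_img.
have Gv : G *m v x = t *: v (sigma x).
  apply/colP=> j; rewrite !mxE !big_ord_recl big_ord0 !mxE /= addr0 !mulr1.
  have -> : lift ord0 ord0 = 1 :> 'I_2 by apply: val_inj.
  case: (unliftP 0 j) => [l ->|-> /=]; last by rewrite -Ex mulrC.
  by rewrite [l]ord1 /= mulr1 /t (_ : lift 0 0 = 1) //; apply: val_inj.
have Gvk k : G *m v (iter k sigma x) = iter k sigma t *: v (iter k.+1 sigma x).
  by rewrite -map_v -{1}(map_G k) -map_mxM Gv map_mxZ map_v iterSr.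
have unit_G : G \in unitmx by rewrite map_unitmx.
have nz_t : t != 0.
  apply/eqP=> t0; have := congr1 (mulmx (invmx G)) Gv; rewrite t0 scale0r mulKmx // mulmx0.
  by move/colP/(_ 1)/eqP; rewrite !mxE /= oner_eq0.
have Gn n : exists2 T, T != 0 & G ^+ n *m v x = T *: v (iter n sigma x).
  elim: n => [|n [T nz_T IHn]]; first by exists 1; rewrite ?oner_eq0 // mul1mx scale1r.
  exists (T * iter n sigma t); first by rewrite mulf_neq0 ?fmorph_eq0.
  by rewrite exprS -mulmxA IHn -scalemxAr Gvk scalerA.
have g_order : g ^+ #|'GL_2[F]%g| = 1.
  have := expg_cardG (in_setT (FinRing.unit 'M[F]_2 unit_g : {'GL_2[F]})).
  by move/(congr1 val); rewrite FinRing.val_unitX /= => ->.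
have [T _] := Gn #|'GL_2[F]%g|; rewrite -rmorphXn /= g_order rmorph1 mul1mx => /colP Ev.
apply: fixf_coprime co_r rx _; apply/fixfP.
by have := Ev 1; have := Ev 0; rewrite !mxE /= mulr1 => Ex1 ET; rewrite [RHS]Ex1 -ET mul1r.
Qed.

Lemma moebius_fixf a b c d x :
    a \in Fix 1 -> b \in Fix 1 -> c \in Fix 1 -> d \in Fix 1 ->
    a * d - b * c != 0 -> x \in Fix r -> sigma x * (c * x + d) = a * x + b ->
  x \in Fix 1.
Proof.
move=> /fixf_frobenius1[a0 ->] /fixf_frobenius1[b0 ->].
move=> /fixf_frobenius1[c0 ->] /fixf_frobenius1[d0 ->] nz_det rx.
pose g : 'M[F]_2 := \matrix_(i, j) if i == 0 then if j == 0 then a0 else b0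
  else if j == 0 then c0 else d0.
suff unit_g : g \in unitmx by move=> E; apply: (moebius_fixf1 unit_g rx); rewrite !mxE.
have det_g : \det g = a0 * d0 - b0 * c0.
  rewrite (expand_det_row _ 0) !big_ord_recl big_ord0 /cofactor !det_mx11 !mxE /=.
  by rewrite expr0 expr1; ring.
by rewrite unitmxE unitfE -(fmorph_eq0 f) det_g rmorphB !rmorphM.
Qed.

Lemma affine_frobenius_fixf y c : y \in Fix r -> c \in Fix 1 -> c != 0 ->
  sigma (sigma y) - sigma y = c * (sigma y - y) -> y \in Fix 1.
Proof.
move=> ry c1 nz_c Ey; have sc : sigma c = c := fixfP c1.
have e1 : sigma y - c * y \in Fix 1.
  apply/fixfP; rewrite /= rmorphB rmorphM /= sc.
  by rewrite -[X in X - _](subrK (sigma y)) Ey; ring.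
apply: moebius_fixf c1 e1 (rpred0 _) (rpred1 _) _ ry _; rewrite ?mulr1 ?mulr0 ?subr0 //.
by ring.
Qed.

(* [(sigma rho - 1) (rho - 1) / rho] is invariant under [sigma]. *)
Lemma cross_ratio_fixf rho : rho \in Fix r -> rho != 0 ->
  sigma (sigma rho) = sigma rho + 1 - sigma rho / rho -> rho \in Fix 1.
Proof.
move=> r_rho nz_rho E; pose J := (sigma rho - 1) * (rho - 1) / rho.
have nz_srho : sigma rho != 0 by rewrite fmorph_eq0.
have J1 : J \in Fix 1.
  apply/fixfP; rewrite /= /J fmorph_div rmorphM !rmorphB rmorph1 /= E.
  by move: (sigma rho) nz_srho => rho1 nz_rho1; field; rewrite nz_rho nz_rho1.
have [J0 | nz_J] := eqVneq J 0.
  suff -> : rho = 1 by apply: rpred1.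
  move/eqP: J0; rewrite !mulf_eq0 invr_eq0 (negPf nz_rho) orbF !subr_eq0.
  by case/orP=> /eqP // s1; apply/(fmorph_inj sigma); rewrite rmorph1.
apply: (@moebius_fixf (J + 1) (-1) 1 (-1)); rewrite ?rpredD ?rpredN1 ?rpred1 //.
  by rewrite (_ : _ - _ = - J) ?oppr_eq0 //; ring.
by rewrite /J; field.
Qed.

Lemma frobenius_form b b' y : b \in Fix 1 -> b' \in Fix 1 ->
  sigma (b * y - b') = b * sigma y - b'.
Proof. by move=> /fixfP Eb /fixfP Eb'; rewrite rmorphB rmorphM; congr (_ * _ - _). Qed.

(* [affine_frobenius_fixf] applies to [l] when [b = 0] and to [1 / (b l - b')] otherwise. *)
Lemma proportional_forms_fixf l kappa b b' : l \in Fix r -> kappa \in Fix 1 -> kappa != 0 ->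
    b \in Fix 1 -> b' \in Fix 1 -> b * l - b' != 0 ->
    kappa * (b * l - b') * (sigma l - sigma (sigma l))
      = (b * sigma (sigma l) - b') * (sigma l - l) ->
  l \in Fix 1.
Proof.
move=> rl k1 nz_k b1 b'1 nz_B; have c1 : - kappa^-1 \in Fix 1 by rewrite rpredN rpredV.
have nz_c : - kappa^-1 != 0 by rewrite oppr_eq0 invr_eq0.
have [b0 | nz_b] := eqVneq b 0.
  rewrite b0 mul0r sub0r oppr_eq0 in nz_B; rewrite b0 !mul0r !sub0r => E.
  apply: affine_frobenius_fixf rl c1 nz_c _; apply: (mulfI (mulf_neq0 nz_k nz_B)).
  transitivity (kappa * - b' * (sigma l - sigma (sigma l))); first by ring.
  by rewrite E; field.
move=> E; set B := b * l - b' in nz_B E.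
have rB : B \in Fix r by rewrite rpredB ?rpredM // (fixf_dvdn (dvd1n r)).
have nz_sB : b * sigma l - b' != 0 by rewrite -frobenius_form ?fmorph_eq0.
have nz_ssB : b * sigma (sigma l) - b' != 0 by rewrite -frobenius_form ?fmorph_eq0.
have inverse_forms l1 l2 : b * l1 - b' != 0 -> b * l2 - b' != 0 ->
    kappa * B * (l1 - l2) = (b * l2 - b') * (l1 - l) ->
  (b * l2 - b')^-1 - (b * l1 - b')^-1 = - kappa^-1 * ((b * l1 - b')^-1 - B^-1).
  move=> nz1 nz2 E12; apply/eqP; rewrite -subr_eq0; apply/eqP.
  transitivity (b * (kappa * B * (l1 - l2) - (b * l2 - b') * (l1 - l))
    / (kappa * B * (b * l1 - b') * (b * l2 - b'))); last by rewrite E12 subrr mulr0 mul0r.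
  by move: nz_B; rewrite /B => nz_B'; field; rewrite nz_k nz_B' nz1 nz2.
have B1 : B^-1 \in Fix 1.
  apply: affine_frobenius_fixf _ c1 nz_c _; first by rewrite rpredV.
  have sB : sigma B^-1 = (b * sigma l - b')^-1.
    by rewrite fmorphV; congr _^-1; apply: frobenius_form.
  have ssB : sigma (b * sigma l - b')^-1 = (b * sigma (sigma l) - b')^-1.
    by rewrite fmorphV; congr _^-1; apply: frobenius_form.
  rewrite sB ssB; apply: inverse_forms => //; exact: E.
have -> : l = (B^-1^-1 + b') / b by rewrite invrK subrK mulrC mulKf.
by rewrite rpred_div // rpredD // rpredV.
Qed.

Lemma independent_forms_fixf l a a' b b' : l \in Fix r ->
    a \in Fix 1 -> a' \in Fix 1 -> b \in Fix 1 -> b' \in Fix 1 ->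
    a * b' != a' * b -> a * l - a' != 0 -> b * l - b' != 0 ->
    (a * l - a') * (sigma l - sigma (sigma l))
      = (b * sigma (sigma l) - b') * (sigma l - l) ->
  l \in Fix 1.
Proof.
move=> rl a1 a'1 b1 b'1 nz_det nz_A nz_B E; rewrite -subr_eq0 in nz_det.
have nz_sB : b * sigma l - b' != 0 by rewrite -frobenius_form ?fmorph_eq0.
have nz_ssB : b * sigma (sigma l) - b' != 0 by rewrite -frobenius_form ?fmorph_eq0.
pose rho := (a * l - a') / (b * l - b').
have r_form c c' : c \in Fix 1 -> c' \in Fix 1 -> c * l - c' \in Fix r.
  by move=> c1 c'1; rewrite rpredB ?rpredM // (fixf_dvdn (dvd1n r)).
have forms_ratio l1 l2 : b * l1 - b' != 0 -> b * l2 - b' != 0 ->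
    (a * l - a') * (l1 - l2) = (b * l2 - b') * (l1 - l) ->
  (a * l2 - a') / (b * l2 - b') = (a * l1 - a') / (b * l1 - b') + 1
    - (a * l1 - a') / (b * l1 - b') / ((a * l - a') / (b * l - b')).
  move=> nz1 nz2 E12; apply/eqP; rewrite -subr_eq0; apply/eqP.
  transitivity ((a * b' - a' * b) * ((a * l - a') * (l1 - l2) - (b * l2 - b') * (l1 - l))
    / ((b * l2 - b') * (b * l1 - b') * (a * l - a'))); last first.
    by rewrite E12 subrr mulr0 mul0r.
  by field; rewrite nz_A nz_B nz1 nz2.
have rho1 : rho \in Fix 1.
  apply: cross_ratio_fixf; first by rewrite rpred_div ?r_form.
    by rewrite mulf_neq0 ?invr_eq0.
  have srho y :
      sigma ((a * y - a') / (b * y - b')) = (a * sigma y - a') / (b * sigma y - b').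
    by rewrite fmorph_div; congr (_ / _); apply: frobenius_form.
  rewrite /rho !srho; apply: forms_ratio => //; exact: E.
have nz_c : a - rho * b != 0.
  apply: contraNneq nz_det => /subr0_eq Ea; have : rho * (b * l - b') = a * l - a'.
    exact: divfK.
  rewrite mulrBr mulrA -Ea => /(addrI _)/oppr_inj <-.
  by rewrite {1}Ea; apply/eqP; ring.
have -> : l = (a' - rho * b') / (a - rho * b).
  apply: (mulIf nz_c); rewrite divfK //; transitivity (a * l - a' + a' - rho * b * l).
    by ring.
  by rewrite -[a * l - a'](divfK nz_B) -/rho; ring.
by rewrite rpred_div // rpredB // rpredM.
Qed.

Lemma pencil_fixf l a a' b b' : l \in Fix r ->
    a \in Fix 1 -> a' \in Fix 1 -> b \in Fix 1 -> b' \in Fix 1 ->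
    a * l - a' != 0 -> b * l - b' != 0 ->
    (a * l - a') * (sigma l - sigma (sigma l))
      = (b * sigma (sigma l) - b') * (sigma l - l) ->
  l \in Fix 1.
Proof.
move=> rl a1 a'1 b1 b'1 nz_A nz_B E.
have [Edet | nz_det] := eqVneq (a * b') (a' * b); last first.
  exact: independent_forms_fixf a1 a'1 b1 b'1 nz_det nz_A nz_B E.
have [kappa k1 [Ea Ea']] :
    exists2 kappa, kappa \in Fix 1 & a = kappa * b /\ a' = kappa * b'.
  have [b0 | nz_b] := eqVneq b 0.
    have nz_b' : b' != 0 by apply: contraNneq nz_B => b'0; rewrite b0 b'0 mul0r subrr.
    exists (a' / b'); rewrite ?rpred_div // divfK // b0 mulr0; split=> //.
    by apply: (mulIf nz_b'); rewrite mul0r Edet b0 mulr0.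
  by exists (a / b); rewrite ?rpred_div // divfK // mulrAC Edet mulfK.
have nz_k : kappa != 0.
  by apply: contraNneq nz_A => k0; rewrite Ea Ea' k0 !mul0r subrr.
apply: (proportional_forms_fixf rl k1 nz_k b1 b'1 nz_B).
by rewrite -E Ea Ea'; ring.
Qed.

Lemma moebius_pencil_fixf l y a a' b b' : l \in Fix r -> y != 0 ->
    a \in Fix 1 -> a' \in Fix 1 -> b \in Fix 1 -> b' \in Fix 1 ->
    (sigma l - l) * y = a * l - a' ->
    (sigma l - sigma (sigma l)) * y = b * sigma (sigma l) - b' ->
  l \in Fix 1.
Proof.
move=> rl nz_y a1 a'1 b1 b'1 Ea Eb; apply: contraT => l1.
have nz_l : sigma l - l != 0 by rewrite subr_eq0.
have nz_sl : sigma l - sigma (sigma l) != 0.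
  by rewrite -rmorphB fmorph_eq0 -opprB oppr_eq0.
apply: contraNT l1 => _; apply: (pencil_fixf rl a1 a'1 b1 b'1).
- by rewrite -Ea mulf_neq0.
- have : sigma (sigma (b * l - b')) != 0 by rewrite !frobenius_form // -Eb mulf_neq0.
  by rewrite !fmorph_eq0.
by rewrite -Ea -Eb; ring.
Qed.

End Moebius.

Section FrobeniusCurve.

Variables (F M : finFieldType) (f : {rmorphism F -> M}) (r : nat) (c : M).
Local Notation sigma := (frobenius f).
Local Notation Fix := (fixf sigma).
Hypotheses (r3c : c \in Fix (r * 3)) (r'c : c \notin Fix r).

Lemma coords3_inj x0 x1 x2 y0 y1 y2 :
    x0 \in Fix r -> x1 \in Fix r -> x2 \in Fix r ->
    y0 \in Fix r -> y1 \in Fix r -> y2 \in Fix r ->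
    x0 + x1 * c + x2 * c ^+ 2 = y0 + y1 * c + y2 * c ^+ 2 ->
  [/\ x0 = y0, x1 = y1 & x2 = y2].
Proof.
move=> rx0 rx1 rx2 ry0 ry1 ry2 E.
have [||||e0 e1 e2] := @fixf_lin_indep3 _ _ r c (x0 - y0) (x1 - y1) (x2 - y2) r3c r'c.
1-3: by rewrite rpredB.
  by apply/eqP; rewrite -[eqbRHS](subrr (x0 + x1 * c + x2 * c ^+ 2)) {2}E; apply/eqP; ring.
by split; apply: subr0_eq.
Qed.

Definition frobenius_curve y := y + sigma y * c + sigma (sigma y) * c ^+ 2.

Definition frobenius_curve_span :=
  adjoin sigma 1 (adjoin sigma 1 [set frobenius_curve y | y in Fix r] 1) (c ^+ 2).

Lemma frobenius_curve_spanP x :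
  reflect (exists y a b, [/\ y \in Fix r, a \in Fix 1, b \in Fix 1
             & x = y + b + sigma y * c + (sigma (sigma y) + a) * c ^+ 2])
          (x \in frobenius_curve_span).
Proof.
apply: (iffP (adjoinP _ _ _ _ _)) => [[u [a [u_span a1 ->]]] | [y [a [b [ry a1 b1 ->]]]]].
  have [_ [b [/imsetP[y ry ->] b1 ->]]] := adjoinP _ _ _ _ _ u_span.
  by exists y, a, b; split=> //; rewrite /frobenius_curve; ring.
exists (frobenius_curve y + b * 1), a; split=> //; last by rewrite /frobenius_curve; ring.
by apply/adjoinP; exists (frobenius_curve y), b; rewrite imset_f.
Qed.

Hypothesis co_r : coprime r #|'GL_2[F]%g|.

Lemma frobenius_curve_span_scattered : fixf_scattered sigma r frobenius_curve_span.
Proof.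
have r1 x : x \in Fix 1 -> x \in Fix r := fixf_dvdn (dvd1n r).
have rs x : x \in Fix r -> sigma x \in Fix r := @fixf_iter _ sigma 1 r x.
move=> l x rl /frobenius_curve_spanP[y [a [b [ry a1 b1 ->]]]] nz_x.
case/frobenius_curve_spanP=> y' [a' [b' [ry' a'1 b'1 E]]].
have [|||||||E0 E1 E2] := @coords3_inj (l * (y + b)) (l * sigma y)
  (l * (sigma (sigma y) + a)) (y' + b') (sigma y') (sigma (sigma y') + a').
all: rewrite ?rpredM ?rpredD //; auto.
  by rewrite -E; ring.
have sE2 : sigma l * sigma (sigma y) = sigma (sigma y').
  by rewrite -rmorphM E1.
have ssE1 : sigma (sigma l) * (sigma (sigma y) + b) = sigma (sigma y') + b'.
  have sE x : x \in Fix 1 -> sigma x = x := fixfP.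
  by rewrite -(sE b b1) -(sE b' b'1) -!rmorphD -rmorphM -(sE b b1) -(sE b' b'1) -!rmorphD
    -rmorphM E0.
have [y0 | nz_y] := eqVneq y 0.
  have y'0 : y' = 0.
    by apply: (fmorph_inj sigma); rewrite [LHS](esym E1) y0 !rmorph0 mulr0.
  rewrite y0 y'0 !rmorph0 !add0r in nz_x E0 E2.
  have [b0 | nz_b] := eqVneq b 0; last by rewrite -(mulfK nz_b l) E0 rpred_div.
  suff nz_a : a != 0 by rewrite -(mulfK nz_a l) E2 rpred_div.
  by apply: contraNneq nz_x => ->; rewrite b0 !mul0r !addr0.
have Ea : (sigma l - l) * sigma (sigma y) = a * l - a'.
  by rewrite mulrBl sE2 -[a'](addKr (sigma (sigma y'))) -E2; ring.
have Eb : (sigma l - sigma (sigma l)) * sigma (sigma y) = b * sigma (sigma l) - b'.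
  by rewrite mulrBl sE2 -[b'](addKr (sigma (sigma y'))) -ssE1; ring.
apply: (@moebius_pencil_fixf _ _ f r co_r l (sigma (sigma y)) a a' b b') => //.
by rewrite !fmorph_eq0.
Qed.

Lemma frobenius_curve_submod : fixf_submod sigma 1 [set frobenius_curve y | y in Fix r].
Proof.
apply: imset_fixf_submod (dvd1n r) _ _ => [x y _ _ | a x /fixfP Ea _].
  by rewrite /frobenius_curve !rmorphD; ring.
have semilinear z : sigma (a * z) = a * sigma z by rewrite rmorphM; congr (_ * _).
by rewrite /frobenius_curve !semilinear; ring.
Qed.

Lemma frobenius_curve_span_scattered_submod :
  scattered_submod sigma 1 r frobenius_curve_span.
Proof.
have sub_r3 x : x \in Fix r -> x \in Fix (r * 3) := fixf_dvdn (dvdn_mulr 3 (dvdnn r)).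
split; last exact: frobenius_curve_span_scattered.
  exact/adjoin_submod/adjoin_submod/frobenius_curve_submod.
apply: adjoin_sub (dvd1n _) (rpredX 2 r3c) _; apply: adjoin_sub (dvd1n _) (rpred1 _) _.
move=> _ /imsetP[y ry ->]; have r_sy := @fixf_iter _ sigma 1 r y ry.
have r_ssy := @fixf_iter _ sigma 2 r y ry.
rewrite !(rpredD, rpredM) ?rpredX //; exact: sub_r3.
Qed.

Lemma card_frobenius_curve_span :
  #|frobenius_curve_span| = (#|Fix r| * #|Fix 1| * #|Fix 1|)%N.
Proof.
have r1 x : x \in Fix 1 -> x \in Fix r := fixf_dvdn (dvd1n r).
have rs x : x \in Fix r -> sigma x \in Fix r := @fixf_iter _ sigma 1 r x.
have W0'1 : 1 \notin [set frobenius_curve y | y in Fix r].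
  apply/imsetP=> -[y ry E].
  have [|||||||Ey Esy _] := @coords3_inj 1 0 0 y (sigma y) (sigma (sigma y)).
  all: rewrite ?rpred1 ?rpred0 //; auto.
    by rewrite !mul0r !addr0.
  by case/eqP: (oner_neq0 M); rewrite Ey; apply: (fmorph_inj sigma); rewrite rmorph0.
have W1'c : c ^+ 2 \notin adjoin sigma 1 [set frobenius_curve y | y in Fix r] 1.
  apply/adjoinP=> -[_ [b [/imsetP[y ry ->] b1 E]]].
  have [|||||||_ Esy Essy] := @coords3_inj 0 0 1 (y + b) (sigma y) (sigma (sigma y)).
  all: rewrite ?rpred1 ?rpred0 ?rpredD //; auto.
    by rewrite mul1r mul0r !add0r {1}E /frobenius_curve; ring.
  by case/eqP: (oner_neq0 M); rewrite Essy -Esy rmorph0.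
have curve_submod := frobenius_curve_submod.
rewrite card_adjoin ?card_adjoin //; last exact: adjoin_submod.
rewrite card_in_imset // => x y rx ry E.
have [] // := @coords3_inj x (sigma x) (sigma (sigma x)) y (sigma y) (sigma (sigma y));
  auto.
Qed.

End FrobeniusCurve.

Theorem coprime_min_length (F : finFieldType) (L : fieldExtType F) r :
    (0 < r)%N -> \dim {:L} = (2 * r)%N -> coprime r #|'GL_2[F]%g| ->
  min_length_saturating L 3 2 (r + 2).
Proof.
move=> r_gt0 dimL co_r; have q_gt1 := finNzRing_gt1 F.
have [|M [i card_d]] := @exists_card_fixf_ext F L (r * 3); first by lia.
have card_r := card_d r (dvdn_mulr 3 (dvdnn r)).
have [|c rk_c r'c] := exists_fixf_diff card_r (card_d _ (dvdnn _)); first by lia.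
have scW := frobenius_curve_span_scattered_submod rk_c r'c co_r.
apply: (scattered_submod_min_length r_gt0 dimL card_d scW).
by rewrite (card_frobenius_curve_span rk_c r'c) card_r card_d ?dvd1n // -mulnA -!expnD.
Qed.

(** * Arithmetic in (Z/p)[X] modulo X^n - c(X) *)

Section PrimeFrobenius.

Variables (M : fieldType) (p : nat).
Hypothesis pM : p \in [pchar M].
Local Notation phi := (pFrobenius_aut pM).

Lemma iter_pFrobenius_aut m x : iter m phi x = x ^+ (p ^ m).
Proof. by elim: m => // m IHm; rewrite iterS IHm pFrobenius_autE -exprM -expnSr. Qed.

Lemma fixf_frobenius_pchar (F : finFieldType) (f : {rmorphism F -> M}) e d x :
  #|F| = (p ^ e)%N -> (x \in fixf (frobenius f) d) = (x \in fixf phi (e * d)).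
Proof. by move=> cardF; rewrite !fixfE iter_frobenius iter_pFrobenius_aut cardF expnM. Qed.

Lemma eqn_mod_pchar a b : a%:R = b%:R :> M -> a = b %[mod p].
Proof.
wlog le_ba : a b / (b <= a)%N => [IH | E].
  by case/orP: (leq_total a b) => h E; [apply/esym/IH | apply: IH].
by apply/eqP; rewrite eqn_mod_dvd // (dvdn_pcharf pM) natrB // E subrr.
Qed.

Lemma natr_modn_pchar a : (a %% p)%:R = a%:R :> M.
Proof. by rewrite [in RHS](divn_eq a p) natrD natrM (pcharf0 pM) mulr0 add0r. Qed.

Lemma fixf_pFrobenius_aut1 x : x \in fixf phi 1 -> exists2 k, (k < p)%N & x = k%:R.
Proof.
move=> x1; have p_pr := pcharf_prime pM.
have [|a Ex] := @fixf_frobenius1 'F_p (pPrimeCharType pM) (in_alg (pPrimeCharType pM)) x.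
  by rewrite fixfE /= /frobenius card_Fp.
exists a; first by rewrite -[ltnRHS](Fp_cast p_pr).
by rewrite Ex -[in LHS](natr_Zp a) rmorph_nat.
Qed.

End PrimeFrobenius.

Definition nat_poly (R : nzRingType) (l : seq nat) : {poly R} := Poly [seq k%:R | k <- l].

Definition monic_nat_poly (R : nzRingType) (c : seq nat) : {poly R} :=
  'X^(size c) - nat_poly R c.

Lemma size_monic_nat_poly (R : nzRingType) c : size (monic_nat_poly R c) = (size c).+1.
Proof.
rewrite size_polyDl size_polyXn // size_polyN ltnS (leq_trans (size_Poly _)) //.
by rewrite size_map.
Qed.

Lemma map_monic_nat_poly (R S : nzRingType) (i : {rmorphism R -> S}) c :
  map_poly i (monic_nat_poly R c) = monic_nat_poly S c.
Proof.
rewrite rmorphB /= map_polyXn map_Poly_id0 ?rmorph0 // -map_comp.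
by congr (_ - Poly _); apply: eq_map => k /=; rewrite rmorph_nat.
Qed.

Lemma root_monic_nat_poly (R : comNzRingType) c (x : R) :
  root (monic_nat_poly R c) x = (x ^+ size c == (nat_poly R c).[x]).
Proof. by rewrite rootE !hornerE subr_eq0. Qed.

Lemma horner_nat_poly_cons (R : nzRingType) k l (x : R) :
  (nat_poly R (k :: l)).[x] = (nat_poly R l).[x] * x + k%:R.
Proof. exact: horner_cons. Qed.

Lemma horner_nat_poly_rcons (R : comNzRingType) k l (x : R) :
  (nat_poly R (rcons l k)).[x] = (nat_poly R l).[x] + k%:R * x ^+ size l.
Proof.
elim: l => [|a l IHl]; rewrite ?rcons_cons !horner_nat_poly_cons ?IHl /= ?exprS.
  by rewrite horner0 expr0; ring.
by ring.
Qed.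

Lemma horner_nat_poly_nseq0 (R : nzRingType) n (x : R) : (nat_poly R (nseq n 0%N)).[x] = 0.
Proof.
elim: n => [|n IHn]; first by rewrite /nat_poly /= horner0.
by rewrite horner_nat_poly_cons IHn mul0r addr0.
Qed.

(* A list of [size c] naturals stands for a residue class modulo [p] and X^(size c) - c. *)
Section Residues.

Variables (p : nat) (c : seq nat).

Definition res_add (l1 l2 : seq nat) := [seq ((a.1 + a.2) %% p)%N | a <- zip l1 l2].
Definition res_scale (k : nat) (l : seq nat) := [seq ((k * a) %% p)%N | a <- l].
Definition res_mulX (l : seq nat) :=
  res_add (0%N :: take (size c).-1 l) (res_scale (last 0%N l) c).
Definition res_mul (l1 l2 : seq nat) :=
  foldr (fun k l => res_add (res_scale k l2) (res_mulX l)) (nseq (size c) 0%N) l1.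
Definition res_exp (l : seq nat) (k : nat) := iter k.-1 (res_mul l) l.
Definition res_X := 0%N :: 1%N :: nseq (size c - 2) 0%N.

Definition res_fixed (m : nat) := iter m (res_exp^~ p) res_X == res_X.

Definition nat_horner (k : nat) (l : seq nat) := foldr (fun a y => a + k * y)%N 0%N l.

Definition res_root_free :=
  all (fun k => (k ^ size c) %% p != nat_horner k c %% p)%N (iota 0 p).

Variable M : fieldType.
Hypothesis pM : p \in [pchar M].
Variable x : M.
Hypotheses (size_c : (1 < size c)%N) (root_x : root (monic_nat_poly M c) x).
Local Notation eval l := (nat_poly M l).[x].

Let size_pow_x : x ^+ size c = eval c.
Proof. by apply/eqP; rewrite -root_monic_nat_poly. Qed.

Lemma size_res_add l1 l2 : size l1 = size c -> size l2 = size c ->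
  size (res_add l1 l2) = size c.
Proof. by move=> E1 E2; rewrite size_map size_zip E1 E2 minnn. Qed.

Lemma size_res_mulX l : size l = size c -> size (res_mulX l) = size c.
Proof.
by move=> E; rewrite size_res_add ?size_map //= size_takel ?prednK ?E ?leq_pred // ltnW.
Qed.

Lemma eval_res_add l1 l2 : size l1 = size l2 ->
  eval (res_add l1 l2) = eval l1 + eval l2.
Proof.
elim: l1 l2 => [|a l1 IHl] [|b l2] //; first by rewrite /nat_poly /= !horner0 addr0.
case=> /IHl{}IHl; rewrite [res_add _ _]/= !horner_nat_poly_cons -/(res_add l1 l2) IHl.
by rewrite (natr_modn_pchar pM) natrD; ring.
Qed.

Lemma eval_res_scale k l : eval (res_scale k l) = k%:R * eval l.
Proof.
elim: l => [|a l IHl]; first by rewrite /nat_poly /= horner0 mulr0.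
rewrite [res_scale _ _]/= !horner_nat_poly_cons -/(res_scale k l) IHl.
by rewrite (natr_modn_pchar pM) natrM; ring.
Qed.

Lemma eval_res_mulX l : size l = size c -> eval (res_mulX l) = x * eval l.
Proof.
case/lastP: l => [|l a]; first by move=> E; move: size_c; rewrite -E.
rewrite size_rcons => E; rewrite /res_mulX -E /= last_rcons -cats1 take_size_cat //.
rewrite eval_res_add; last by rewrite /= size_map.
rewrite eval_res_scale cats1 horner_nat_poly_rcons horner_nat_poly_cons.
by rewrite -size_pow_x -E exprS; ring.
Qed.

Lemma size_res_mul l1 l2 : size l2 = size c -> size (res_mul l1 l2) = size c.
Proof.
move=> E2; elim: l1 => [|a l1 IHl] /=; first by rewrite size_nseq.
by apply: size_res_add; [rewrite size_map | apply: size_res_mulX].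
Qed.

Lemma eval_res_mul l1 l2 : size l2 = size c -> eval (res_mul l1 l2) = eval l1 * eval l2.
Proof.
move=> E2; elim: l1 => [|a l1 IHl] /=.
  by rewrite horner_nat_poly_nseq0 /nat_poly /= horner0 mul0r.
have size_l1 := size_res_mul l1 E2.
rewrite eval_res_add; last by rewrite size_map size_res_mulX.
by rewrite eval_res_scale eval_res_mulX // IHl horner_nat_poly_cons; ring.
Qed.

Lemma size_res_exp l k : size l = size c -> size (res_exp l k) = size c.
Proof.
by move=> E; rewrite /res_exp; elim: k.-1 => //= m; apply: size_res_mul.
Qed.

Lemma eval_res_exp l k : (0 < k)%N -> size l = size c -> eval (res_exp l k) = eval l ^+ k.
Proof.
case: k => // k _ E; elim: k => [|k IHk] //.
by rewrite [res_exp _ _]/= eval_res_mul ?(size_res_exp k.+1) // exprS -IHk.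
Qed.

Lemma size_res_X : size res_X = size c.
Proof. by rewrite /= size_nseq; lia. Qed.

Lemma eval_res_X : eval res_X = x.
Proof. by rewrite !horner_nat_poly_cons horner_nat_poly_nseq0; ring. Qed.

Lemma res_fixedP m : res_fixed m -> x \in fixf (pFrobenius_aut pM) m.
Proof.
move/eqP=> E; apply/fixfP; rewrite iter_pFrobenius_aut -[RHS]eval_res_X -{}E.
have size_iter n : size (iter n (res_exp^~ p) res_X) = size c.
  by elim: n => [|n IHn]; [apply: size_res_X | apply: size_res_exp].
elim: m => [|m IHm]; first by rewrite eval_res_X.
by rewrite iterS eval_res_exp // ?prime_gt0 ?(pcharf_prime pM) // -IHm expnSr exprM.
Qed.

Lemma natr_nat_horner k l : (nat_horner k l)%:R = (nat_poly M l).[k%:R].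
Proof.
elim: l => [|a l IHl]; first by rewrite /nat_poly /= horner0.
by rewrite horner_nat_poly_cons -IHl /= natrD natrM; ring.
Qed.

Lemma res_root_freeP : res_root_free -> x \notin fixf (pFrobenius_aut pM) 1.
Proof.
move/allP=> no_root; apply/negP=> /fixf_pFrobenius_aut1[k lt_kp Ex].
have := no_root k; rewrite mem_iota lt_kp => /(_ isT)/eqP; apply.
by apply: (eqn_mod_pchar pM); rewrite natrX natr_nat_horner -Ex size_pow_x.
Qed.

End Residues.

Lemma res_fixed_frobenius (F : finFieldType) (M : fieldType) (f : {rmorphism F -> M})
    p e m c (x : M) :
    p \in [pchar M] -> #|F| = (p ^ e)%N -> coprime e m -> (1 < size c)%N ->
    root (monic_nat_poly M c) x -> res_fixed p c m -> res_root_free p c ->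
  x \in fixf (frobenius f) m /\ x \notin fixf (frobenius f) 1.
Proof.
move=> pM cardF co_em size_c root_x /(res_fixedP pM size_c root_x) x_m.
move=> /(res_root_freeP pM root_x) x'1; rewrite !(fixf_frobenius_pchar pM f _ _ cardF).
split; first exact: fixf_dvdn (dvdn_mull _ _) x_m.
by apply: contra x'1; rewrite muln1 => e_x; apply: fixf_coprime co_em e_x x_m.
Qed.

(** * Exponent 5 *)

Lemma cramer2_eq0 (R : idomainType) (a b c d x y : R) :
  x * a + y * b = 0 -> x * c + y * d = 0 -> a * d - c * b != 0 -> x = 0 /\ y = 0.
Proof.
move=> E1 E2 nz_det; split; apply: (mulIf nz_det); rewrite mul0r.
  transitivity (d * (x * a + y * b) - b * (x * c + y * d)); first by ring.
  by rewrite E1 E2 !mulr0 subrr.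
transitivity (a * (x * c + y * d) - c * (x * a + y * b)); first by ring.
by rewrite E1 E2 !mulr0 subrr.
Qed.

(* Let th^5 = A + B th + C th^2, g = tau th^2 + th^3, z = tau th + th^4. Up to sign, this
   is the determinant in the basis 1, th, .., th^4 of (1, g, mu, mu g, z), where
   mu = m0 + m1 th + .. + m4 th^4 for any [m0]. *)
Definition quintic_det (M : comNzRingType) (tau A B C m1 m2 m3 m4 : M) : M :=
  (m2 - tau * m3)
    * (B * m2 + A * m3 + tau * (B * m3 + (A - C) * m4 - m1) - tau ^+ 2 * m2)
  - (m1 - tau * m4) * (C * m2 + B * m3 + A * m4 - tau ^+ 2 * (m1 + C * m4)).

Definition quintic_anisotropic (M : fieldType) (S : {pred M}) (tau A B C : M) :=
  forall m1 m2 m3 m4, m1 \in S -> m2 \in S -> m3 \in S -> m4 \in S ->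
    quintic_det tau A B C m1 m2 m3 m4 = 0 -> [/\ m1 = 0, m2 = 0, m3 = 0 & m4 = 0].

Section Quintic.

Variables (M : finFieldType) (sigma : {rmorphism M -> M}) (th tau A B C : M).
Local Notation Fix := (fixf sigma).
Hypothesis card_5 : #|Fix 5| = (#|Fix 1| ^ 5)%N.
Hypotheses (th5 : th \in Fix 5) (th1 : th \notin Fix 1) (tau3 : tau \in Fix 3).
Hypotheses (A1 : A \in Fix 1) (B1 : B \in Fix 1) (C1 : C \in Fix 1).
Hypothesis Dth : th ^+ 5 = A + B * th + C * th ^+ 2.
Hypothesis anisotropic : quintic_anisotropic (Fix 1) tau A B C.

Let g := tau * th ^+ 2 + th ^+ 3.
Let z := tau * th + th ^+ 4.

Let fix13 x : x \in Fix 1 -> x \in Fix 3 := fixf_dvdn (dvd1n 3).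

Lemma quintic_indep a0 a1 a2 a3 a4 :
    a0 \in Fix 3 -> a1 \in Fix 3 -> a2 \in Fix 3 -> a3 \in Fix 3 -> a4 \in Fix 3 ->
    a0 + a1 * th + a2 * th ^+ 2 + a3 * th ^+ 3 + a4 * th ^+ 4 = 0 ->
  [/\ a0 = 0, a1 = 0, a2 = 0, a3 = 0 & a4 = 0].
Proof.
move=> h0 h1 h2 h3 h4 E; have th15 : th \in Fix (3 * 5) by apply: fixf_dvdn th5.
have th'3 : th \notin Fix 3 by apply: contra th1 => th3; apply: (@fixf_coprime _ _ 3 5).
have /and5P[/eqP-> /eqP-> /eqP-> /eqP-> /andP[/eqP-> _]] :
  all (pred1 0) [:: a0; a1; a2; a3; a4]; last by [].
apply: (fixf_lin_indep (n := 5) _ th15 th'3) => //.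
  by move=> x; rewrite !inE => /or4P[||| /orP[]] /eqP->.
by rewrite !big_ord_recl big_ord0 /bump /= -[RHS]E; ring.
Qed.

Lemma quintic_decomp mu : mu \in Fix 5 -> exists m0 m1 m2 m3 m4,
  [/\ m0 \in Fix 1, m1 \in Fix 1, m2 \in Fix 1, m3 \in Fix 1 & m4 \in Fix 1] /\
  mu = m0 + m1 * th + m2 * th ^+ 2 + m3 * th ^+ 3 + m4 * th ^+ 4.
Proof.
case/(@power_comb_onto M sigma 1 5 th mu isT th5 th1 card_5) => m m1 ->.
exists (m 0), (m 1), (m 2%:R), (m 3%:R), (m 4%:R); split; first by split.
rewrite /power_comb !big_ord_recl big_ord0 /bump /= expr0 mulr1 expr1 addr0 !addrA.
by congr (_ + m _ * _ + m _ * _ + m _ * _ + m _ * _); apply: val_inj.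
Qed.

Lemma quintic_relations m0 m1 m2 m3 m4 s' t' s t a :
    m0 \in Fix 1 -> m1 \in Fix 1 -> m2 \in Fix 1 -> m3 \in Fix 1 -> m4 \in Fix 1 ->
    s' \in Fix 3 -> t' \in Fix 3 -> s \in Fix 3 -> t \in Fix 3 -> a \in Fix 1 ->
    (m0 + m1 * th + m2 * th ^+ 2 + m3 * th ^+ 3 + m4 * th ^+ 4) * (s' + t' * g)
      = s + t * g + a * z ->
  s' * (m2 - tau * m3) + t' * (C * m2 + B * m3 + A * m4 - tau ^+ 2 * (m1 + C * m4)) = 0 /\
  s' * (m1 - tau * m4) + t' * (B * m2 + A * m3 + tau * (B * m3 + (A - C) * m4 - m1)
    - tau ^+ 2 * m2) = 0.
Proof.
move=> /fix13 h0 /fix13 h1 /fix13 h2 /fix13 h3 /fix13 h4 s'3 t'3 s3 t3 /fix13 a3 E.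
have [A3 B3 C3] : [/\ A \in Fix 3, B \in Fix 3 & C \in Fix 3] by split; apply: fix13.
have [||||||_ e1 e2 e3 e4] := @quintic_indep
  (m0 * s' + t' * (A * (m2 + tau * m3)) - s)
  (m1 * s' + t' * (tau * (B * m3 + A * m4) + B * m2 + A * m3) - a * tau)
  (m2 * s' + t' * (tau * (C * m3 + B * m4) + C * m2 + B * m3 + A * m4 + m0 * tau) - t * tau)
  (m3 * s' + t' * (tau * (m1 + C * m4) + C * m3 + B * m4 + m0) - t)
  (m4 * s' + t' * (tau * m2 + m1 + C * m4) - a).
1-5: by rewrite !(rpredB, rpredD, rpredM).
  transitivity ((m0 + m1 * th + m2 * th ^+ 2 + m3 * th ^+ 3 + m4 * th ^+ 4) * (s' + t' * g)
    - (s + t * g + a * z) - (th ^+ 5 - (A + B * th + C * th ^+ 2))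
      * (t' * (tau * m3 + m2 + (tau * m4 + m3) * th + m4 * th ^+ 2))).
    by rewrite /g /z; ring.
  by rewrite E Dth !subrr mul0r subr0.
split; first by rewrite -[RHS](subrr 0) -{1}e2 -(mulr0 tau) -e3; ring.
by rewrite -[RHS](subrr 0) -{1}e1 -(mulr0 tau) -e4; ring.
Qed.

Lemma quintic_dependence_eq0 mu s' t' s t a : mu \in Fix 5 -> mu \notin Fix 1 ->
    s' \in Fix 3 -> t' \in Fix 3 -> s \in Fix 3 -> t \in Fix 3 -> a \in Fix 1 ->
    mu * (s' + t' * g) = s + t * g + a * z -> s' = 0 /\ t' = 0.
Proof.
case/quintic_decomp=> m0 [m1 [m2 [m3 [m4 [[h0 h1 h2 h3 h4] Dmu]]]]] mu1 s'3 t'3 s3 t3 a1.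
rewrite Dmu => /(quintic_relations h0 h1 h2 h3 h4 s'3 t'3 s3 t3 a1)[rel1 rel2].
apply: (cramer2_eq0 rel1 rel2).
apply: contraNneq mu1 => /(anisotropic h1 h2 h3 h4)[z1 z2 z3 z4].
by rewrite Dmu z1 z2 z3 z4 !mul0r !addr0.
Qed.

Definition quintic_plane := adjoin sigma 3 (adjoin sigma 3 [set 0] 1) g.

Definition quintic_span := adjoin sigma 1 quintic_plane z.

Lemma quintic_planeP x :
  reflect (exists s t, [/\ s \in Fix 3, t \in Fix 3 & x = s + t * g]) (x \in quintic_plane).
Proof.
apply: (iffP (adjoinP _ _ _ _ _)) => [[y [t [y_plane t3 ->]]] | [s [t [s3 t3 ->]]]].
  have [_ [s [/set1P-> s3 ->]]] := adjoinP _ _ _ _ _ y_plane.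
  by exists s, t; rewrite add0r mulr1.
exists s, t; split=> //; apply/adjoinP; exists 0, s.
by rewrite set11 add0r mulr1.
Qed.

Let coprime35_fix1 x : x \in Fix 5 -> x \in Fix 3 -> x \in Fix 1.
Proof. exact: (@fixf_coprime _ _ 5 3). Qed.

Lemma quintic_unobstructed1 : 1 \notin obstruction sigma 3 5 [set 0].
Proof.
apply/obstructionP=> -[l [c [x [y [l5 l1 c3 [/set1P-> /set1P-> E]]]]]].
case/negP: l1; apply: coprime35_fix1 l5 _.
by move: E; rewrite mul1r mulr0 subr0 => /subr0_eq->.
Qed.

Lemma quintic_unobstructed_g : g \notin obstruction sigma 3 5 (adjoin sigma 3 [set 0] 1).
Proof.
apply/obstructionP=> -[l [c [x [y [l5 l1 c3 [x_line y_line E]]]]]].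
have [_ [s' [/set1P-> s'3 Ex]]] := adjoinP _ _ _ _ _ x_line.
have [_ [s [/set1P-> s3 Ey]]] := adjoinP _ _ _ _ _ y_line.
have [||||||||_ /eqP] := @quintic_dependence_eq0 l s' 1 s c 0; rewrite ?rpred0 ?rpred1 //.
  transitivity (l * x + g * (l - c) + c * g); first by rewrite Ex; ring.
  by rewrite E Ey; ring.
by rewrite oner_eq0.
Qed.

Lemma quintic_unobstructed_z : z \notin obstruction sigma 1 5 quintic_plane.
Proof.
apply/obstructionP=> -[l [c [x [y [l5 l1 c1 [/quintic_planeP[s' [t' [s'3 t'3 Ex]]]]]]]]].
case/quintic_planeP=> s [t [s3 t3 Ey]] E.
have lc1 : l - c \notin Fix 1 by rewrite rpredBr.
have lcV1 : (l - c)^-1 \notin Fix 1 by rewrite rpredV.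
have c3 := fix13 c1; have c5 : c \in Fix 5 := fixf_dvdn (dvd1n 5) c1.
have nz_lc : l - c != 0 by apply: contraNneq lc1 => ->; apply: rpred0.
have Exz : (l - c)^-1 * (s - c * s' + (t - c * t') * g) = s' + t' * g + 1 * z.
  apply: (mulfI nz_lc); rewrite mulVKf //.
  transitivity ((l - c) * x + z * (l - c)); last by rewrite Ex; ring.
  by rewrite E Ex Ey; ring.
have [||||||e0 e1] := quintic_dependence_eq0 _ lcV1 _ _ _ _ _ Exz.
all: rewrite ?rpredV ?rpredB ?rpredM ?rpred1 //.
have := Exz; rewrite e0 e1 mul0r addr0 mulr0 => /esym xz0.
have [||||||_ _ _ _ /eqP] := @quintic_indep s' tau (t' * tau) t' 1.
all: rewrite ?rpredM ?rpred1 ?oner_eq0 //.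
by rewrite -[RHS]xz0 /g /z; ring.
Qed.

Lemma quintic_plane_scattered_submod : scattered_submod sigma 3 5 quintic_plane.
Proof.
have th15 : th \in Fix (5 * 3) by apply: fixf_dvdn th5.
have tau15 : tau \in Fix (5 * 3) by apply: fixf_dvdn tau3.
apply: adjoin_scattered_submod quintic_unobstructed_g => //.
  by rewrite rpredD ?rpredM ?rpredX.
apply: adjoin_scattered_submod quintic_unobstructed1; rewrite ?rpred1 //.
exact: scattered_submod0.
Qed.

Lemma quintic_span_scattered_submod : scattered_submod sigma 1 5 quintic_span.
Proof.
have th15 : th \in Fix (5 * 3) by apply: fixf_dvdn th5.
have tau15 : tau \in Fix (5 * 3) by apply: fixf_dvdn tau3.
apply: adjoin_scattered_submod quintic_unobstructed_z => //.
  by rewrite rpredD ?rpredM ?rpredX.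
have [plane_submod sub15 sc] := quintic_plane_scattered_submod.
by split=> //; apply: fixf_submod_dvdn plane_submod.
Qed.

Lemma card_quintic_span :
  #|quintic_span| = (#|Fix 3| * #|Fix 3| * #|Fix 1|)%N.
Proof.
have notin d W x : fixf_submod sigma d W -> x \notin obstruction sigma d 5 W -> x \notin W.
  by move=> dW; apply: contra; apply/subsetP/(obstruction_sub dW th5 th1).
have [submod0 _ _] := scattered_submod0 sigma 3 5.
have submod1 : fixf_submod sigma 3 (adjoin sigma 3 [set 0] 1) by apply: adjoin_submod.
have [submod2 _ _] := quintic_plane_scattered_submod.
have {}submod2 : fixf_submod sigma 1 quintic_plane by apply: fixf_submod_dvdn submod2.
rewrite card_adjoin ?card_adjoin ?cards1 ?mul1n //.
- exact: notin quintic_unobstructed1.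
- exact: notin quintic_unobstructed_g.
exact: notin quintic_unobstructed_z.
Qed.

End Quintic.

Lemma sqrf_eq0_imp (R : idomainType) (x : R) : x ^+ 2 = 0 -> x = 0.
Proof. by move/eqP; rewrite sqrf_eq0 => /eqP. Qed.

Lemma monomial_curve (M : fieldType) (y0 y2 y3 y4 : M) :
    y0 != 0 -> y2 ^+ 2 = y0 * y4 -> y3 ^+ 2 = y2 * y4 -> let s := y3 / y2 in
  [/\ y2 = s ^+ 2 * y0, y3 = s ^+ 3 * y0 & y4 = s ^+ 4 * y0].
Proof.
move=> nz0 E2 E3 s; have E4 : y4 = y2 ^+ 2 / y0 by rewrite E2 mulrC mulKf.
have [z2 | nz2] := eqVneq y2 0.
  have z3 : y3 = 0 by apply: sqrf_eq0_imp; rewrite E3 z2 mul0r.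
  by rewrite E4 /s z2 z3 !mul0r !expr0n !mul0r.
have Es2 : s ^+ 2 = y2 / y0 by rewrite /s expr_div_n E3 E4; field; rewrite nz0 nz2.
split; first by rewrite Es2 divfK.
  by rewrite exprS Es2 mulrA divfK // /s divfK.
by rewrite (exprM s 2 2) Es2 E4; field.
Qed.

Section Anisotropic.

Variables (M : fieldType) (sigma : {rmorphism M -> M}) (tau : M).
Local Notation Fix := (fixf sigma).
Hypotheses (tau3 : tau \in Fix 3) (tau1 : tau \notin Fix 1).

(* Two of the three quadrics cut out by the determinant have the curve
   (m1, m4, m3, m2) = (1, s^2, s^3, s^4) as common zeros. *)
Lemma quintic_anisotropic_linear0 C t : C \in Fix 1 -> t \in Fix 1 -> C != 0 ->
    tau ^+ 3 = -1 + t * tau ^+ 2 ->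
    (forall s, s \in Fix 1 -> s ^+ 8 != 1 + (C - t) * s ^+ 2 + s ^+ 3 - C * t * s ^+ 4
       + (C - 1) * s ^+ 5 + t * s ^+ 7) ->
  quintic_anisotropic (Fix 1) tau 1 0 C.
Proof.
move=> C1 t1 nzC Dtau no_root m1 m2 m3 m4 h1 h2 h3 h4 det0.
have [||||Q0 Q1 Q2] := @fixf_lin_indep3 _ sigma 1 tau (C * (m4 ^+ 2 - m1 * m2))
  (m2 * m4 - m1 * m2 - m3 ^+ 2 + m4 ^+ 2)
  (m1 ^+ 2 + m1 * m3 - m2 ^+ 2 + (C - 1) * m3 * m4 + C * m1 * m4
     + t * (m2 * m3 - m1 * m4 - C * m4 ^+ 2)) tau3 tau1.
1-3: by rewrite !(rpredB, rpredD, rpredM, rpredX, rpred1).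
  transitivity (quintic_det tau 1 0 C m1 m2 m3 m4
    - (tau ^+ 3 - (-1 + t * tau ^+ 2)) * (m2 * m3 - m1 * m4 - C * m4 ^+ 2)).
    by rewrite /quintic_det; ring.
  by rewrite det0 Dtau subrr mul0r subr0.
have E4 : m4 ^+ 2 = m1 * m2 by apply/subr0_eq/(mulfI nzC); rewrite Q0 mulr0.
have E3 : m3 ^+ 2 = m4 * m2.
  transitivity (m4 * m2 + (m4 ^+ 2 - m1 * m2)
    - (m2 * m4 - m1 * m2 - m3 ^+ 2 + m4 ^+ 2)); first by ring.
  by rewrite Q1 E4; ring.
have [z1 | nz1] := eqVneq m1 0.
  have z4 : m4 = 0 by apply: sqrf_eq0_imp; rewrite E4 z1 mul0r.
  have z3 : m3 = 0 by apply: sqrf_eq0_imp; rewrite E3 z4 mul0r.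
  by split=> //; apply/sqrf_eq0_imp/oppr_inj; rewrite oppr0 -Q2 z1 z3 z4; ring.
have [E4s E3s E2s] := monomial_curve nz1 E4 E3; set s := m3 / m4 in E4s E3s E2s.
have /no_root/eqP[] : s \in Fix 1 by rewrite rpred_div.
apply/eqP; rewrite -subr_eq0; apply/eqP/(mulIf (expf_neq0 2 nz1)); rewrite mul0r.
by rewrite -[RHS]oppr0 -Q2 E2s E3s E4s; ring.
Qed.

(* The same curve, now with (B m3 + m4, m1, m2, m3) = (1, s^2, s^3, s^4). *)
Lemma quintic_anisotropic_quadratic0 B t : B \in Fix 1 -> t \in Fix 1 -> B != 0 ->
    tau ^+ 3 = -1 + t * tau ->
    (forall s, s \in Fix 1 -> s ^+ 8 != 1 - t * s ^+ 2 + s ^+ 3 - B * s ^+ 4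
       - s ^+ 5 + B * t * s ^+ 6 + (t - B) * s ^+ 7) ->
  quintic_anisotropic (Fix 1) tau 1 B 0.
Proof.
move=> B1 t1 nzB Dtau no_root m1 m2 m3 m4 h1 h2 h3 h4 det0.
have [||||Q0 Q1 Q2] := @fixf_lin_indep3 _ sigma 1 tau (B * (m2 ^+ 2 - m1 * m3))
  (m2 * m4 - m1 * m2 - m3 ^+ 2 + B * m3 * m4 + m4 ^+ 2 + t * (m2 * m3 - m1 * m4))
  (m1 ^+ 2 + m1 * m3 - m2 ^+ 2 - B * m3 ^+ 2 - m3 * m4) tau3 tau1.
1-3: by rewrite !(rpredB, rpredD, rpredM, rpredX, rpred1).
  transitivity (quintic_det tau 1 B 0 m1 m2 m3 m4
    - (tau ^+ 3 - (-1 + t * tau)) * (m2 * m3 - m1 * m4)).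
    by rewrite /quintic_det; ring.
  by rewrite det0 Dtau subrr mul0r subr0.
have E2 : m2 ^+ 2 = m1 * m3 by apply/subr0_eq/(mulfI nzB); rewrite Q0 mulr0.
have E1 : m1 ^+ 2 = (B * m3 + m4) * m3.
  transitivity ((B * m3 + m4) * m3 + (m2 ^+ 2 - m1 * m3)
    + (m1 ^+ 2 + m1 * m3 - m2 ^+ 2 - B * m3 ^+ 2 - m3 * m4)); first by ring.
  by rewrite Q2 E2; ring.
have [z0 | nz0] := eqVneq (B * m3 + m4) 0.
  have z1 : m1 = 0 by apply: sqrf_eq0_imp; rewrite E1 z0 mul0r.
  have z2 : m2 = 0 by apply: sqrf_eq0_imp; rewrite E2 z1 mul0r.
  have z3 : m3 = 0.
    apply: sqrf_eq0_imp; rewrite -[RHS](subrr 0) -{1}(mulr0 m4) -{1}z0 -Q1 z1 z2.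
    by ring.
  by split=> //; rewrite -z0 z3 mulr0 add0r.
have [E1s E2s E3s] := monomial_curve nz0 E1 E2; set s := m2 / m1 in E1s E2s E3s.
have E4s : m4 = (1 - B * s ^+ 4) * (B * m3 + m4).
  by rewrite mulrBl mul1r -mulrA -E3s; ring.
have /no_root/eqP[] : s \in Fix 1 by rewrite rpred_div.
apply/eqP; rewrite -subr_eq0; apply/eqP/(mulIf (expf_neq0 2 nz0)); rewrite mul0r.
rewrite -[RHS]oppr0 -Q1.
move: (B * m3 + m4) E1s E2s E3s E4s => y0 -> -> -> ->.
by ring.
Qed.

End Anisotropic.

Lemma exists_root_dvdp_prod (R : fieldType) (P : {poly R}) (zs : seq R) :
  P %| \prod_(z <- zs) ('X - z%:P) -> (1 < size P)%N -> exists x, root P x.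
Proof.
case/dvdp_prod_XsubC=> m Em; rewrite (eqp_size Em) (size_prod_XsubC _ id).
case Dm: (mask m zs) => [|z s] //= _; exists z.
by rewrite (eqp_root Em) root_prod_XsubC Dm mem_head.
Qed.

Section PrimeCharacteristic.

Variables (F : finFieldType) (L : fieldExtType F) (p e : nat).
Hypotheses (p_pr : prime p) (cardF : #|F| = (p ^ e)%N) (co_e15 : coprime e 15).
Hypothesis dimL : \dim {:L} = (2 * 5)%N.

Lemma quintic_min_length (A B C : nat) (cubic : seq nat) (quintic := [:: A; B; C; 0; 0]%N) :
    size cubic = 3 -> res_fixed p quintic 5 -> res_root_free p quintic ->
    res_fixed p cubic 3 -> res_root_free p cubic ->
    (forall (M : finFieldType) (f : {rmorphism F -> M}) tau, p \in [pchar M] ->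
       root (monic_nat_poly M cubic) tau ->
       tau \in fixf (frobenius f) 3 -> tau \notin fixf (frobenius f) 1 ->
     quintic_anisotropic (fixf (frobenius f) 1) tau A%:R B%:R C%:R) ->
  min_length_saturating L 3 2 (5 + 2).
Proof.
move=> size_cubic quintic_fixed quintic_free cubic_fixed cubic_free anisotropic.
have [||M [i [zs [dvd_zs card_d]]]] :=
  @exists_fixf_ext F L 15 (monic_nat_poly L quintic * monic_nat_poly L cubic) => //.
  by rewrite mulf_neq0 // -size_poly_eq0 size_monic_nat_poly.
rewrite rmorphM /= !map_monic_nat_poly in dvd_zs.
have [th root_th] : exists th, root (monic_nat_poly M quintic) th.
  apply: (@exists_root_dvdp_prod _ _ zs); last by rewrite size_monic_nat_poly.
  by apply: dvdp_trans dvd_zs; apply: dvdp_mulr.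
have [tau root_tau] : exists tau, root (monic_nat_poly M cubic) tau.
  apply: (@exists_root_dvdp_prod _ _ zs); last by rewrite size_monic_nat_poly size_cubic.
  by apply: dvdp_trans dvd_zs; apply: dvdp_mull.
have pM : p \in [pchar M].
  by apply: (rmorph_pchar (i \o in_alg L)); apply: card_finPcharP cardF p_pr.
have [co3 co5] : coprime e 3 /\ coprime e 5 by split; apply: coprime_dvdr co_e15.
pose f : {rmorphism F -> M} := i \o in_alg L.
have [//|th5 th1] :=
  res_fixed_frobenius f pM cardF co5 _ root_th quintic_fixed quintic_free.
have [|tau3 tau1] := res_fixed_frobenius f pM cardF co3 _ root_tau cubic_fixed cubic_free.
  by rewrite size_cubic.
have card_5 : #|fixf (frobenius f) 5| = (#|fixf (frobenius f) 1| ^ 5)%N by rewrite !card_d.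
have Dth : th ^+ 5 = A%:R + B%:R * th + C%:R * th ^+ 2.
  move: root_th; rewrite root_monic_nat_poly => /eqP->.
  rewrite !horner_nat_poly_cons /nat_poly /= horner0.
  by ring.
have scW := quintic_span_scattered_submod card_5 th5 th1 tau3 (rpred_nat _ A)
  (rpred_nat _ B) (rpred_nat _ C) Dth (anisotropic M f tau pM root_tau tau3 tau1).
apply: (scattered_submod_min_length _ dimL card_d scW) => //.
rewrite (card_quintic_span card_5 th5 th1 tau3 (rpred_nat _ A) (rpred_nat _ B)
  (rpred_nat _ C) Dth (anisotropic M f tau pM root_tau tau3 tau1)).
by rewrite !card_d // -!expnD.
Qed.

End PrimeCharacteristic.

Section SmallCharacteristic.

Variables (F : finFieldType) (L : fieldExtType F) (e : nat).
Hypotheses (dimL : \dim {:L} = (2 * 5)%N) (co_e15 : coprime e 15).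

Lemma not_root_frobenius_fixf1 (M : fieldType) (f : {rmorphism F -> M}) p c x :
    p \in [pchar M] -> #|F| = (p ^ e)%N -> (1 < size c)%N -> res_fixed p c 15 ->
    res_root_free p c -> x \in fixf (frobenius f) 1 -> ~~ root (monic_nat_poly M c) x.
Proof.
move=> pM cardF size_c c_fixed c_free x1; apply/negP=> root_x.
have [_ /negP[]//] := res_fixed_frobenius f pM cardF co_e15 size_c root_x c_fixed c_free.
Qed.

Lemma quintic_char2_min_length : #|F| = (2 ^ e)%N -> min_length_saturating L 3 2 (5 + 2).
Proof.
move=> cardF.
apply: (quintic_min_length (A := 1) (B := 0) (C := 1) (cubic := [:: 1; 0; 1]%N)
  _ cardF co_e15 dimL) => // M f tau M2 root_tau tau3 tau1; have E2 := pcharf0 M2.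
apply: (quintic_anisotropic_linear0 (t := 1) tau3 tau1); rewrite ?rpred1 ?oner_neq0 //.
  move: root_tau; rewrite root_monic_nat_poly => /eqP->.
  rewrite !horner_nat_poly_cons /nat_poly /= horner0.
  by apply/eqP; rewrite -subr_eq0; apply/eqP; rewrite -[RHS]E2; ring.
move=> s s1; apply: contraNneq (not_root_frobenius_fixf1
  (c := [:: 1; 0; 0; 1; 1; 0; 0; 1]%N) M2 cardF isT isT isT s1) => E.
rewrite root_monic_nat_poly [size _]/= E -subr_eq0 !horner_nat_poly_cons /nat_poly /= horner0.
apply/eqP; transitivity (2%:R * (- s ^+ 4)); first by ring.
by rewrite E2 mul0r.
Qed.

Lemma quintic_char5_min_length : #|F| = (5 ^ e)%N -> min_length_saturating L 3 2 (5 + 2).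
Proof.
move=> cardF.
apply: (quintic_min_length (A := 1) (B := 0) (C := 2) (cubic := [:: 4; 0; 3]%N)
  _ cardF co_e15 dimL) => // M f tau M5 root_tau tau3 tau1; have E5 := pcharf0 M5.
apply: (quintic_anisotropic_linear0 (t := 3%:R) tau3 tau1); rewrite ?rpred_nat //.
- by rewrite -(dvdn_pcharf M5).
- move: root_tau; rewrite root_monic_nat_poly => /eqP->.
  rewrite !horner_nat_poly_cons /nat_poly /= horner0.
  by apply/eqP; rewrite -subr_eq0; apply/eqP; rewrite -[RHS]E5; ring.
move=> s s1; apply: contraNneq (not_root_frobenius_fixf1
  (c := [:: 1; 0; 4; 1; 4; 1; 0; 3]%N) M5 cardF isT isT isT s1) => E.
rewrite root_monic_nat_poly [size _]/= E -subr_eq0 !horner_nat_poly_cons /nat_poly /= horner0.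
apply/eqP; transitivity (5%:R * (- s ^+ 2 - 2%:R * s ^+ 4)); first by ring.
by rewrite E5 mul0r.
Qed.

Lemma quintic_char3_min_length : #|F| = (3 ^ e)%N -> min_length_saturating L 3 2 (5 + 2).
Proof.
move=> cardF.
apply: (quintic_min_length (A := 1) (B := 1) (C := 0) (cubic := [:: 2; 1; 0]%N)
  _ cardF co_e15 dimL) => // M f tau M3 root_tau tau3 tau1; have E3 := pcharf0 M3.
apply: (quintic_anisotropic_quadratic0 (t := 1) tau3 tau1); rewrite ?rpred1 ?oner_neq0 //.
  move: root_tau; rewrite root_monic_nat_poly => /eqP->.
  rewrite !horner_nat_poly_cons /nat_poly /= horner0.
  by apply/eqP; rewrite -subr_eq0; apply/eqP; rewrite -[RHS]E3; ring.
move=> s s1; apply: contraNneq (not_root_frobenius_fixf1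
  (c := [:: 1; 0; 2; 1; 2; 2; 1; 0]%N) M3 cardF isT isT isT s1) => E.
rewrite root_monic_nat_poly [size _]/= E -subr_eq0 !horner_nat_poly_cons /nat_poly /= horner0.
apply/eqP; transitivity (3%:R * (- s ^+ 2 - s ^+ 4 - s ^+ 5)); first by ring.
by rewrite E3 mul0r.
Qed.

End SmallCharacteristic.

Local Close Scope ring_scope.

Lemma coprime_GL2 (F : finFieldType) r :
  coprime r #|F| -> coprime r #|F|.-1 -> coprime r #|F|.+1 -> coprime r #|'GL_2[F]%g|.
Proof. by move=> co0 coN co1; rewrite card_GL_2 !coprimeMr co0 coN co1. Qed.

Lemma coprime5_GL2 (F : finFieldType) :
  #|F| = 2 %[mod 5] \/ #|F| = 3 %[mod 5] -> coprime 5 #|'GL_2[F]%g|.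
Proof. by move=> qm; apply: coprime_GL2; rewrite prime_coprime //; lia. Qed.

Lemma odd_exp2_mod5 h : 2 ^ (2 * h + 1) = 2 %[mod 5] \/ 2 ^ (2 * h + 1) = 3 %[mod 5].
Proof.
elim: h => [|h IHh]; first by left.
by rewrite mulnS -addnA 2!expnS; lia.
Qed.

Lemma coprime_fact_GL2 (F : finFieldType) r s : 0 < s ->
  coprime r (#|F| ^ (2 * s) - #|F| ^ s + 1)`! -> coprime r #|'GL_2[F]%g|.
Proof.
have := finNzRing_gt1 F; set q := #|F| => q_gt1 s_gt0 co.
have co_le m : 0 < m <= q ^ (2 * s) - q ^ s + 1 -> coprime r m.
  by move=> le_m; apply: coprime_dvdr co; apply: dvdn_fact.
have q_le : q <= q ^ s by rewrite -{1}(expn1 q) leq_exp2l.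
have sqr_qs : q ^ (2 * s) = q ^ s * q ^ s by rewrite mul2n -addnn expnD.
by apply: coprime_GL2; apply: co_le; rewrite -/q sqr_qs; nia.
Qed.

Theorem theorem4p9 (q r : nat) (F : finFieldType) (L : fieldExtType F)
    (q_pp : prime_power q) (r_gt0 : 0 < r)
    (cardF : #|F| = q) (dimL : \dim {:L} = 2 * r)
    (cases :
      (* (a) *)
      [/\ r <> 3 %[mod 6], r <> 5 %[mod 6] & 4 <= r]
      (* (b) *)
      \/ (odd r /\
          exists s : nat,
            [/\ 1 <= s, s <= r, gcdn r s = 1
              & gcdn r (q ^ (2 * s) - q ^ s + 1)`! = 1])
      (* (c) *)
      \/ (r = 5 /\
          exists p h s : nat,
            [/\ p = 2 \/ p = 3, gcdn s 15 = 1 & q = p ^ (15 * h + s)])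
      (* (d) *)
      \/ (r = 5 /\ exists h : nat, q = 5 ^ (15 * h + 1))
      (* (e) *)
      \/ (r = 5 /\
          ((odd q /\ (q = 2 %[mod 5] \/ q = 3 %[mod 5]))
           \/ exists h : nat, 1 <= h /\ q = 2 ^ (2 * h + 1)))) :
  min_length_saturating L 3 2 (r + 2).
Proof.
case: cases => [[r3 r5 r4]|[[_ [s [s1 _ _ co]]]|[[r5 [p [h [s [p23 co Eq]]]]]
    |[[r5 [h Eq]]|[r5 qmod]]]]].
- have [r31|r31] := eqVneq (r %% 3) 1; first by apply: mod3_min_length => //; lia.
  have Er : r = r %/ 2 * 2 by lia.
  rewrite Er in dimL *; have [t3|t3] := boolP (3 %| r %/ 2).
    by apply: even_dvdn3_min_length => //; lia.
  by apply: even_coprime3_min_length => //; rewrite 1?coprime_sym ?prime_coprime //; lia.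
- apply: coprime_min_length => //; apply: coprime_fact_GL2 s1 _.
  by rewrite /coprime cardF co.
- rewrite r5 in dimL *; have co_e : coprime (15 * h + s) 15.
    by rewrite /coprime gcdnC mulnC gcdnMDl gcdnC co.
  case: p23 => Ep; rewrite Ep in Eq.
    by apply: (quintic_char2_min_length dimL co_e); rewrite cardF.
  by apply: (quintic_char3_min_length dimL co_e); rewrite cardF.
- rewrite r5 in dimL *; apply: (quintic_char5_min_length (e := 15 * h + 1) dimL).
    by rewrite /coprime gcdnC mulnC gcdnMDl.
  by rewrite cardF.
rewrite r5 in dimL *; apply: coprime_min_length => //; apply: coprime5_GL2.
by rewrite cardF; case: qmod => [[_ //]|[h [_ ->]]]; apply: odd_exp2_mod5.
Qed.
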